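(* Every hyperbolic plane curve possesses a definite Hermitian determinantal representation. Explicitly: let $f\in\mathbb{R}[x,y,z]$ be homogeneous of degree $d\ge1$ and hyperbolic with respect to a point $e\in\mathbb{R}^3$, with the sign of $f$ normalized so that $f(e)>0$. Then there exist Hermitian $d\times d$ matrices $M_0,M_1,M_2$ such that $$f=\det(xM_0+yM_1+zM_2),$$ and there is a point $e'\in\mathbb{R}^3$ for which $e'_0M_0+e'_1M_1+e'_2M_2$ is positive definite.
   Context: A homogeneous polynomial $f\in\mathbb{R}[x,y,z]$ is hyperbolic with respect to $e\in\mathbb{R}^3$ if $f(e)\ne0$ and for every $a\in\mathbb{R}^3$ all roots of the univariate polynomial $f(te+a)\in\mathbb{R}[t]$ are real. The plane curve defined by $f$ is allowed to be singular. *)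

(* Defs.v *)
From HB Require Import structures.
From mathcomp Require Import all_boot all_order all_algebra.
From mathcomp Require Import sesquilinear spectral.
From mathcomp Require Import reals.
From mathcomp Require Import complex.
From mathcomp Require Import mpoly.

Set Implicit Arguments.
Unset Strict Implicit.
Unset Printing Implicit Defensive.

Import GRing.Theory Num.Theory.

Local Open Scope ring_scope.
Local Open Scope sesquilinear_scope.

(* The univariate polynomial f(t e + a) in the variable t = 'X. *)
Definition line_restr (R : realType) (n : nat) (f : {mpoly R[n]})
    (e a : 'I_n -> R) : {poly R} :=
  mmap (@polyC R) (fun i => e i *: 'X + (a i)%:P) f.

(* The roots are taken in the complex numbers, and are required to be real.
   If f is homogeneous then f(e) is the coefficient of t^d in f(t e + a), so
   this univariate polynomial is never zero. *)
Definition hyperbolic (R : realType) (n : nat) (f : {mpoly R[n]})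
    (e : 'I_n -> R) : Prop :=
  f.@[e] != 0 /\
  forall (a : 'I_n -> R) (z : R[i]),
    root (map_poly (real_complex R) (line_restr f e a)) z -> complex.Im z = 0.

(* The order on R[i] is partial: 0 < w says that w is real and positive. *)
Definition posdefmx (R : realType) (d : nat) (A : 'M[R[i]]_d) : Prop :=
  A \is hermsymmx /\
  forall v : 'cV[R[i]]_d, v != 0 -> 0 < (v ^t* *m A *m v) 0 0.

Definition pencil (R : realType) (n d : nat) (M : 'I_n -> 'M[R[i]]_d) :
    'M[{mpoly R[i][n]}]_d :=
  \sum_(i < n) 'X_i *: map_mx (@mpolyC n R[i]) (M i).

(* Main.v *)
Require Import Defs.
From HB Require Import structures.
From mathcomp Require Import all_boot all_order all_algebra.
From mathcomp Require Import ring zify.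
From mathcomp Require Import perm sesquilinear spectral.
From mathcomp Require Import reals.
From mathcomp Require Import complex.
From mathcomp Require Import mpoly.

Set Implicit Arguments.
Unset Strict Implicit.
Unset Printing Implicit Defensive.

Import Order.TTheory GRing.Theory Num.Theory.

Local Open Scope ring_scope.
Local Open Scope sesquilinear_scope.

(** Complete [e] to a basis [e, b, c] of the space and put
    [q(y, t) = f (t e + y b + c) / f (e)]. This is a monic polynomial in [t] with
    coefficients in [C[y]], hyperbolicity says that for every real [y] all its
    roots are real, and homogeneity says that these roots grow at most linearly
    in [y]. It is enough to write [q] as the characteristic polynomial of
    [A0 + y A1] with [A0] and [A1] Hermitian: homogenizing again gives
    [f (t e + y b + z c) = f (e) det (t - y A1 - z A0)], the factor [f (e) > 0]
    is absorbed by a congruence, and the pencil is positive definite at [e].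

    To find [A0] and [A1], let multiplication by [t] act on the lattice
    [C[y][t] / q], free of rank [d] over [C[y]]. It is self-adjoint for the trace
    form, whose Gram matrix [H = (tr t^(i+j))] is positive semidefinite at every
    real [y] because the roots are real. If [H] is degenerate, a null vector is a
    polynomial of degree less than [d] that vanishes at the roots of every real
    fiber, so [q] factors over [C[y]] by Gauss's lemma and induction on the
    degree applies, with block diagonal matrices ([trace_form_degenerate]).

    If [H] is nondegenerate, the lattice is enlarged until the form becomes the
    standard one. Let [x] be a complex root of [det H]. The kernel of [H(x)] is
    stable under the operator, hence contains an eigenvector [v]; the lattice
    obtained by adjoining [v / (y - x)] is still stable, its Gram matrix is still
    polynomial and positive semidefinite, and the degree of [det H] has dropped
    by two ([selfadj_divide]); for real [x] this uses that a nonnegative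
    polynomial has only multiple real roots. When [det H] has become constant, a
    reduction of the basis with respect to degrees, the analogue of this step at
    infinity, makes [H] itself constant ([selfadj_lower_degree]), and a constant
    change of basis makes it the identity ([selfadj_hermitian]). The operator is
    then given by a polynomial matrix that is Hermitian at every real [y] with
    eigenvalues of at most linear growth, and so are its entries: it is of the form
    [A0 + y A1] ([hermitian_linear]). This is a form of the matrix Fejer-Riesz
    factorization on the line in which the operator is carried along.

    Vectors are rows: a change of basis [P] turns the Gram matrix [H] into
    [P H P^*] and the operator [A] into [P A P^-1], and self-adjointness reads
    [A H = H A^*]. *)

(** * Complex polynomials that are nonnegative on the real line *)

Section NonnegPoly.
Variable C : numClosedFieldType.
Implicit Types (p : {poly C}) (y s : C).

(** The nonnegative numbers form a closed subset of the complex ones: [a] is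
    approached by the nonnegative [a + s b] as [s] tends to 0, so [a = |a|]. *)
Lemma ge0_lim (a B : C) : 0 <= B ->
  (forall s, 0 < s -> s <= 1 -> exists2 b, `|b| <= B & 0 <= a + s * b) -> 0 <= a.
Proof.
move=> B0 H.
suff /eqP : `|a - `|a| | = 0 by rewrite normr_eq0 subr_eq0 => /eqP->; rewrite normr_ge0.
set e := `|_|; apply/eqP; rewrite eq_le normr_ge0 andbT.
rewrite real_leNgt ?normr_real ?real0 //; apply/negP => e0.
have D0 : 0 < e + 4 * B + 1.
  by rewrite ltr_wpDl // addr_ge0 ?mulr_ge0 ?normr_ge0 ?ler0n.
(* Any [s <= 1] with [2 s B < e] contradicts the estimate below. *)
pose s := e / (e + 4 * B + 1).
have s0 : 0 < s by rewrite divr_gt0.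
have s1 : s <= 1.
  by rewrite ler_pdivrMr // mul1r -addrA lerDl addr_ge0 ?mulr_ge0 ?ler0n ?ler01.
have [b bB ab] := H _ s0 s1.
have : e <= 2 * (s * B).
  have aE : a - `|a| = (a - (a + s * b)) + (`|a + s * b| - `|a|).
    by rewrite (ger0_norm ab) addrA addrNK.
  rewrite /e aE; apply: le_trans (ler_normD _ _) _.
  rewrite mulr_natl mulr2n lerD //.
    rewrite opprD addrA subrr add0r normrN normrM gtr0_norm //.
    by rewrite ler_pM2l.
  apply: le_trans (ler_dist_dist _ _) _.
  rewrite addrAC subrr add0r normrM gtr0_norm //.
  by rewrite ler_pM2l.
rewrite mulrCA /s -mulrA ler_pMr // ler_pdivlMl // mulr1.
rewrite real_leNgt ?realD ?real1 ?realM ?realn ?ger0_real // ?ltW // => /negP; apply.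
have B24 : 2 * B <= 4 * B by rewrite ler_wpM2r // ler_nat.
by rewrite ltr_pwDr // ler_wpDl // ltW.
Qed.

Lemma horner_norm_le p s : `|s| <= 1 -> `|p.[s]| <= \sum_(i < size p) `|p`_i|.
Proof.
move=> s1; rewrite horner_coef; apply: le_trans (ler_norm_sum _ _ _) _.
apply: ler_sum => i _; rewrite normrM normrX ler_piMr //.
by rewrite exprn_ile1.
Qed.

Lemma ge0_horner0 p : (forall s, 0 < s -> 0 <= p.[s]) -> 0 <= p`_0.
Proof.
move=> H; rewrite -horner_coef0.
have /factor_theorem[r pE] : root (p - (p.[0])%:P) 0.
  by rewrite rootE !hornerE subrr.
have {}pE x : p.[x] = p.[0] + x * r.[x].
  have /(congr1 (fun q => q.[x])) := pE.
  by rewrite !hornerE subr0 => /(canRL (subrK _)) ->; rewrite addrC mulrC.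
apply: (@ge0_lim _ (\sum_(i < size r) `|r`_i|)); first by rewrite sumr_ge0.
move=> s s0 s1; exists r.[s]; first by apply: horner_norm_le; rewrite gtr0_norm.
by rewrite -pE H.
Qed.

Lemma ge0_horner_right p y :
  (forall s, 0 < s -> 0 <= p.[y + s]) -> 0 <= p.[y].
Proof.
move=> H; have -> : p.[y] = (p \Po ('X + y%:P))`_0.
  by rewrite -horner_coef0 horner_comp !hornerE ?subr0 ?add0r.
apply: ge0_horner0 => s s0.
by rewrite horner_comp !hornerE addrC H.
Qed.

Lemma ge0_horner_left p y :
  (forall s, 0 < s -> 0 <= p.[y - s]) -> 0 <= p.[y].
Proof.
move=> H; have -> : p.[y] = (p \Po (y%:P - 'X))`_0.
  by rewrite -horner_coef0 horner_comp !hornerE ?subr0 ?add0r.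
apply: ge0_horner0 => s s0.
by rewrite horner_comp !hornerE H.
Qed.

Definition nonneg p := forall y, y \is Num.real -> 0 <= p.[y].

Lemma nonneg_punctured p x : x \is Num.real ->
  (forall y, y \is Num.real -> y != x -> 0 <= p.[y]) -> nonneg p.
Proof.
move=> xR H y yR; have [->|] := eqVneq y x; last exact: H.
apply: ge0_horner_right => s s0; apply: H; first by rewrite realD // gtr0_real.
by rewrite -subr_eq0 addrAC subrr add0r gt_eqF.
Qed.

(** At a simple root the polynomial would change sign: its quotient by ['X - x] is
    nonnegative on the right of [x] and nonpositive on the left. *)
Lemma nonneg_double_root p x : x \is Num.real -> nonneg p -> root p x ->
  ('X - x%:P) * ('X - x%:P) %| p.
Proof.
move=> xR p0 /factor_theorem[g pE]; rewrite pE dvdp_mul // dvdp_XsubCl.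
have H s : 0 < `|s| -> s \is Num.real -> 0 <= g.[x + s] * s.
  move=> s0 sR; have /p0 : x + s \is Num.real by rewrite realD.
  by rewrite pE !hornerE addrAC subrr add0r.
rewrite rootE eq_le; apply/andP; split; last first.
  apply: ge0_horner_right => s s0; rewrite -(pmulr_lge0 _ s0).
  by apply: H; rewrite ?gtr0_norm ?gtr0_real.
rewrite -oppr_ge0 -hornerN; apply: ge0_horner_left => s s0; rewrite -(pmulr_lge0 _ s0).
by rewrite hornerN mulNr -mulrN; apply: H; rewrite ?normrN ?realN ?gtr0_norm ?gtr0_real.
Qed.

(** The reversed polynomial takes the value [s^k p(1/s)] at [s > 0], and its
    constant coefficient is the coefficient of degree [k] of [p]. *)
Lemma nonneg_lead k p : (size p <= k.+1)%N -> nonneg p -> 0 <= p`_k.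
Proof.
move=> szp p0; pose r := \poly_(i < k.+1) p`_(k - i).
have -> : p`_k = r`_0 by rewrite coef_poly subn0.
apply: ge0_horner0 => s s0.
suff -> : r.[s] = s ^+ k * p.[s^-1].
  by rewrite mulr_ge0 ?exprn_ge0 ?(ltW s0) // p0 // realV gtr0_real.
rewrite horner_poly (horner_coef_wide _ szp) mulr_sumr.
rewrite (reindex_inj rev_ord_inj) /=; apply: eq_bigr => i _.
rewrite subSS subKn -1?ltnS // mulrCA; congr (_ * _).
by rewrite exprVn expfB_cond // (gt_eqF s0) -ltnS ltn_ord.
Qed.

(** Both [p(y)] and [p(-y)] are nonnegative, with opposite coefficients in odd
    degree. *)
Lemma nonneg_odd k p : odd k -> (size p <= k.+1)%N -> nonneg p -> p`_k = 0.
Proof.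
move=> ok szp p0; apply/eqP; rewrite eq_le (nonneg_lead szp) // andbT.
have szr : (size (p \Po - 'X) <= k.+1)%N.
  by rewrite size_comp_poly2 // size_polyN size_polyX.
have /(nonneg_lead szr) : nonneg (p \Po - 'X).
  by move=> y yR; rewrite horner_comp hornerN hornerX; apply: p0; rewrite realN.
rewrite (_ : (p \Po - 'X)`_k = - p`_k) ?oppr_ge0 //.
rewrite -['X]scale1r -scaleNr.
rewrite comp_polyE coef_sum.
have [kp|pk] := ltnP k (size p); last first.
  rewrite big1 ?nth_default ?oppr0 // => i _.
  by rewrite exprZn !coefZ coefXn gtn_eqF ?mulr0 // (leq_trans (ltn_ord i)).
rewrite (bigD1 (Ordinal kp)) //= big1 ?addr0 => [|i /negbTE ik].
  by rewrite exprZn !coefZ coefXn eqxx mulr1 -signr_odd ok mulrN1.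
rewrite exprZn !coefZ coefXn (_ : (k == i) = false) ?mulr0 //.
by rewrite eq_sym -ik.
Qed.

Lemma poly_real_eq0 p : (forall y, y \is Num.real -> p.[y] = 0) -> p = 0.
Proof.
move=> H; apply/eqP; apply: contraT => p0.
pose rs : seq C := [seq i%:R | i <- iota 0 (size p)].
suff : (size rs < size p)%N by rewrite size_map size_iota ltnn.
apply: max_poly_roots => //.
  by apply/allP => _ /mapP[i _ ->]; rewrite rootE H ?realn.
by rewrite map_inj_uniq ?iota_uniq // => i j /eqP; rewrite eqr_nat => /eqP.
Qed.

End NonnegPoly.

(** * Self-adjoint operators on Hermitian lattices over [C[y]] *)

Lemma char_poly_similar (R : comNzRingType) n (P P' A : 'M[R]_n) :
  P *m P' = 1%:M -> char_poly (P *m A *m P') = char_poly A.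
Proof.
move=> PP'; rewrite /char_poly.
have <- : map_mx polyC P *m char_poly_mx A *m map_mx polyC P' =
  char_poly_mx (P *m A *m P').
  rewrite /char_poly_mx mulmxBr mulmxBl -!map_mxM /= scalar_mxC -[X in X - _]mulmxA.
  by rewrite -map_mxM PP' map_mx1 mulmx1.
rewrite !det_mulmx mulrAC -det_mulmx -map_mxM PP'.
by rewrite map_mx1 det1 mul1r.
Qed.

Section HermPolyMx.
Variable C : numClosedFieldType.

(** The polynomial whose values at real points are conjugate to those of [p]. *)
Definition star (p : {poly C}) : {poly C} := map_poly Num.conj p.
HB.instance Definition _ := GRing.RMorphism.copy star (map_poly Num.conj).

Lemma star_coef p i : (star p)`_i = (p`_i)^*.
Proof. by rewrite coef_map. Qed.

Lemma starK : involutive star.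
Proof. by move=> p; apply/polyP => i; rewrite !star_coef conjCK. Qed.

Lemma size_star p : size (star p) = size p.
Proof. exact: size_map_poly. Qed.

Lemma starX : star 'X = 'X. Proof. exact: map_polyX. Qed.

Lemma starC c : star c%:P = (c^*)%:P. Proof. exact: map_polyC. Qed.

Lemma horner_star p y : (star p).[y^*] = (p.[y])^*.
Proof. exact: horner_map. Qed.

Lemma horner_star_real p y : y \is Num.real -> (star p).[y] = (p.[y])^*.
Proof. by move=> /CrealP yE; rewrite -{1}yE horner_star. Qed.

Definition adjm m n (A : 'M[{poly C}]_(m, n)) : 'M[{poly C}]_(n, m) :=
  map_mx star A^T.

Lemma adjmE m n (A : 'M[{poly C}]_(m, n)) i j : adjm A i j = star (A j i).
Proof. by rewrite !mxE. Qed.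

Lemma adjmK m n (A : 'M[{poly C}]_(m, n)) : adjm (adjm A) = A.
Proof. by apply/matrixP => i j; rewrite !adjmE starK. Qed.

Lemma adjmM m n p (A : 'M_(m, n)) (B : 'M_(n, p)) :
  adjm (A *m B) = adjm B *m adjm A.
Proof. by rewrite /adjm trmx_mul map_mxM. Qed.

Lemma adjm1 n : adjm (1%:M : 'M_n) = 1%:M.
Proof. by rewrite /adjm trmx1 map_mx1. Qed.

Lemma det_adjm n (A : 'M_n) : \det (adjm A) = star (\det A).
Proof. by rewrite /adjm det_map_mx det_tr. Qed.

Definition evalm m n (y : C) (A : 'M[{poly C}]_(m, n)) : 'M[C]_(m, n) :=
  map_mx (horner_eval y) A.

Lemma evalmE m n y (A : 'M_(m, n)) i j : evalm y A i j = (A i j).[y].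
Proof. by rewrite mxE. Qed.

Lemma evalmM m n p y (A : 'M_(m, n)) (B : 'M_(n, p)) :
  evalm y (A *m B) = evalm y A *m evalm y B.
Proof. exact: map_mxM. Qed.

Lemma det_evalm n y (A : 'M_n) : \det (evalm y A) = (\det A).[y].
Proof. exact: det_map_mx. Qed.

Lemma evalm_const m n y (A : 'M_(m, n)) : evalm y (map_mx polyC A) = A.
Proof. by apply/matrixP => i j; rewrite !mxE /horner_eval hornerC. Qed.

Lemma evalm_adjm m n y (A : 'M_(m, n)) : y \is Num.real ->
  evalm y (adjm A) = (evalm y A)^t*.
Proof.
move=> yR; apply/matrixP => i j.
by rewrite !mxE /horner_eval horner_star_real.
Qed.

(** Positivity can only be asked at real points, where the value of a Hermitian
    polynomial matrix is a Hermitian matrix. *)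
Definition psd n (H : 'M[{poly C}]_n) :=
  forall y, y \is Num.real ->
  forall v : 'rV[C]_n, 0 <= (v *m evalm y H *m v ^t*) 0 0.

Lemma psd_nonneg n (H : 'M_n) (w : 'rV[{poly C}]_n) : psd H ->
  nonneg ((w *m H *m adjm w) 0 0).
Proof.
move=> Hp y yR; rewrite -evalmE !evalmM evalm_adjm //; exact: Hp.
Qed.

Lemma psd_nonneg_const n (H : 'M_n) :
  (forall v : 'rV[C]_n,
     nonneg ((map_mx polyC v *m H *m adjm (map_mx polyC v)) 0 0)) -> psd H.
Proof.
move=> Hp y yR v; have := Hp v y yR.
by rewrite -evalmE !evalmM evalm_adjm // evalm_const.
Qed.

Lemma psd_diag n (H : 'M_n) i : psd H -> nonneg (H i i).
Proof.
move=> Hp; have := psd_nonneg (delta_mx 0 i) Hp.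
rewrite -rowE (_ : adjm _ = delta_mx i 0) -?colE ?mxE //.
by apply/matrixP => a b; rewrite adjmE !mxE rmorph_nat [_ && _]andbC.
Qed.

Lemma psd_congr n m (H : 'M_n) (P : 'M_(m, n)) :
  psd H -> psd (P *m H *m adjm P).
Proof.
move=> Hp y yR v; have := Hp y yR (v *m evalm y P).
by rewrite !evalmM evalm_adjm // trmx_mul map_mxM !mulmxA.
Qed.

(** At a real point, the value of the form at [e_j - t h^* e_i], where [h] and
    [k] are the entries of index [(i, j)] and [(j, j)], is [k - 2 t |h|^2];
    it must stay nonnegative for all [t >= 0]. *)
Lemma psd_diag0 n (H : 'M_n) i j : psd H -> adjm H = H ->
  H i i = 0 -> H i j = 0.
Proof.
move=> Hp Hh Hii; apply: poly_real_eq0 => y yR.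
set h := (H i j).[y]; set k := (H j j).[y].
have hE : (H j i).[y] = h^* by rewrite -Hh adjmE horner_star_real.
have k0 : 0 <= k by apply: psd_diag.
have key t : 0 <= t -> 0 <= k - 2 * t * `|h| ^+ 2.
  move=> t0.
  pose v : 'rV[C]_n := (- t * h^*) *: delta_mx 0 i + delta_mx 0 j.
  have := Hp y yR v; rewrite /v.
  have vT : ((- t * h^*) *: delta_mx 0 i + delta_mx 0 j : 'rV[C]_n)^t*
            = (- t * h) *: delta_mx i 0 + delta_mx j 0.
    apply/matrixP => a b; rewrite !mxE rmorphD rmorphM /= rmorphM rmorphN /=.
    rewrite conjCK !rmorph_nat [t^*](CrealP _) ?ger0_real //.
    by rewrite ![(b == _) && _]andbC.
  rewrite vT mulmxDl !mulmxDr !mulmxDl -?scalemxAr -?scalemxAl -?scalemxAr -?scalemxAl.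
  rewrite -!rowE -!colE !mxE /horner_eval Hii horner0 hE -/h -/k.
  rewrite normCK !mulr0 add0r addrA => /le_trans; apply.
  rewrite le_eqVlt; apply/orP; left; apply/eqP; ring.
have [/eqP|h0] := eqVneq h 0; first by move/eqP.
have hp : 0 < `|h| ^+ 2 by rewrite exprn_gt0 // normr_gt0.
(* This value of [t] makes the expression equal to [-1]. *)
have : 0 <= k - 2 * ((k + 1) / (2 * `|h| ^+ 2)) * `|h| ^+ 2.
  by apply: key; rewrite divr_ge0 ?addr_ge0 ?mulr_ge0 ?ler01 ?ler0n ?(ltW hp).
rewrite (_ : k - _ = - 1); first by rewrite oppr_ge0 ler10.
by field; rewrite normr_eq0.
Qed.

(** [H] is the Gram matrix of a form on the lattice of row vectors, and [A] an
    operator on this lattice. *)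
Definition selfadj (q : {poly {poly C}}) n (H A : 'M[{poly C}]_n) :=
  [/\ adjm H = H, psd H, A *m H = H *m adjm A & char_poly A = q].

Lemma selfadj_basis q n (H A P P' : 'M_n) : P *m P' = 1%:M ->
  selfadj q H A -> selfadj q (P *m H *m adjm P) (P *m A *m P').
Proof.
move=> PP' [Hh Hp HA qE]; have P'P := mulmx1C PP'.
split; last by rewrite char_poly_similar.
- by rewrite !adjmM adjmK Hh mulmxA.
- exact: psd_congr.
- rewrite !adjmM !mulmxA -(mulmxA (P *m A)) P'P mulmx1.
  rewrite -(mulmxA (P *m H)) -adjmM P'P adjm1 mulmx1.
  by rewrite -(mulmxA P A) HA !mulmxA.
Qed.

(** The determinant of an invertible polynomial matrix is a constant. *)
Lemma size_det_basis n (H P P' : 'M[{poly C}]_n) : P *m P' = 1%:M ->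
  size (\det (P *m H *m adjm P)) = size (\det H).
Proof.
move=> PP'; have := congr1 determinant PP'; rewrite det_mulmx det1 => PP'1.
have sP : size (\det P) == 1%N.
  rewrite -dvdp1; apply/dvdpP; exists (\det P'); by rewrite mulrC PP'1.
have /size_poly1P[c c0 cE] := sP.
rewrite !det_mulmx det_adjm cE starC mulrAC -polyCM mul_polyC size_scale //.
by rewrite mulf_neq0 ?conjC_eq0.
Qed.

End HermPolyMx.

(** * Enlarging the lattice at a root of the determinant *)

(** The transvection [1 + u w], where [u] is a basis column and [w = v - e_i],
    has inverse [1 - u w] over the ring itself because [w u = 0]. *)
Lemma basis_with_row (R : comNzRingType) n (v : 'rV[R]_n) i : v 0 i = 1 ->
  exists P P' : 'M_n, [/\ P *m P' = 1%:M, 'e_i *m P = v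
    & forall j, j != i -> 'e_j *m P = 'e_j :> 'rV_n].
Proof.
move=> vi; pose u : 'cV[R]_n := delta_mx i 0; pose w := v - 'e_i.
have wu : w *m u = 0.
  apply/matrixP => a b; rewrite -colE !mxE !ord1 vi.
  by rewrite ?eqxx ?subrr.
have vE : v = 'e_i + w by rewrite subrKC.
clearbody w; rewrite {}vE {v vi}.
exists (1%:M + u *m w), (1%:M - u *m w); split.
- rewrite mulmxDl mul1mx mulmxBr mulmx1 -[_ *m _ *m (_ *m _)]mulmxA.
  by rewrite [w *m (_ *m _)]mulmxA wu mul0mx mulmx0 subr0 subrK.
- rewrite mulmxDr mulmx1 mulmxA mul_delta_mx.
  by rewrite (_ : delta_mx 0 0 = 1%:M) ?mul1mx //;
     apply/matrixP=> a b; rewrite !mxE !ord1 !eqxx.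
- move=> j ji; rewrite mulmxDr mulmx1 mulmxA.
  by rewrite mul_delta_mx_0 ?mul0mx ?addr0.
Qed.

Section LocalStep.
Variable C : numClosedFieldType.

(** The commutation relation makes the kernel of [K] stable under [A], and every
    nonzero stable space contains an eigenvector. *)
Lemma kernel_eigenvector n (K A B : 'M[C]_n) :
  \det K = 0 -> A *m K = K *m B ->
  exists (v : 'rV_n) a, [/\ v != 0, v *m K = 0 & v *m A = a *: v].
Proof.
move=> dK AK; pose U := row_base (kermx K).
have UK : U *m K = 0 by apply/sub_kermxP; rewrite eq_row_base.
have /submxP[X UA] : (U *m A <= U)%MS.
  rewrite (eqmxMr A (eq_row_base _)) eq_row_base; apply/sub_kermxP.
  by rewrite -mulmxA AK mulmxA mulmx_ker mul0mx.
have [|a /eigenvalueP[w wX w0]] := @eigenvalue_closed C _ X.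
  rewrite lt0n mxrank_eq0; apply/negP => /eqP kK0.
  have /row_freeP[K' KK'] : row_free K by rewrite -kermx_eq0 kK0.
  have := congr1 determinant KK'; rewrite det_mulmx dK mul0r det1 => /eqP.
  by rewrite eq_sym oner_eq0.
exists (w *m U), a; split.
- by rewrite mulmx_free_eq0 ?row_base_free.
- by rewrite -mulmxA UK mulmx0.
- by rewrite -mulmxA UA mulmxA wX scalemxAl.
Qed.

(** The vector of index [i] of the adapted basis is an eigenvector of [A(x)] in
    the kernel of [H(x)]; a constant change of basis suffices. *)
Lemma selfadj_adapted q n (H A : 'M[{poly C}]_n) x :
  selfadj q H A -> root (\det H) x ->
  exists i (H1 A1 : 'M_n), [/\ selfadj q H1 A1, size (\det H1) = size (\det H),
    forall j, root (H1 i j) x & forall j, j != i -> root (A1 i j) x].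
Proof.
move=> sHA rx; have [_ _ HA _] := sHA.
have [||v0 [a [v0n0 v0H v0A]]] := @kernel_eigenvector _ (evalm x H) (evalm x A)
   (evalm x (adjm A)).
- by rewrite det_evalm; apply/eqP.
- by rewrite -!evalmM HA.
have [i vi] : exists i, v0 0 i != 0 by apply/rV0Pn.
pose v := (v0 0 i)^-1 *: v0.
have vH : v *m evalm x H = 0 by rewrite -scalemxAl v0H scaler0.
have vA : v *m evalm x A = a *: v by rewrite -scalemxAl v0A scalerA mulrC -scalerA.
have [|P [P' [PP' Pi _]]] := @basis_with_row C _ v i; first by rewrite mxE mulVf.
have vP' : v *m P' = 'e_i by rewrite -Pi -mulmxA PP' mulmx1.
pose Q : 'M_n := map_mx polyC P; pose Q' : 'M_n := map_mx polyC P'.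
have QQ' : Q *m Q' = 1%:M by rewrite /Q /Q' -map_mxM PP' map_mx1.
exists i, (Q *m H *m adjm Q), (Q *m A *m Q'); split.
- exact: selfadj_basis.
- exact: size_det_basis QQ'.
- move=> j; have : ('e_i : 'rV_n) *m evalm x (Q *m H *m adjm Q) = 0.
    by rewrite !evalmM evalm_const !mulmxA Pi vH mul0mx.
  by move=> /rowP/(_ j); rewrite -rowE !mxE => /eqP.
- move=> j ji; have : ('e_i : 'rV_n) *m evalm x (Q *m A *m Q') = a *: ('e_i : 'rV_n).
    by rewrite !evalmM !evalm_const !mulmxA Pi vA -scalemxAl vP'.
  move=> /rowP/(_ j); rewrite -rowE !mxE (negbTE ji) mulr0 => /eqP.
  by [].
Qed.

(** This is the passage to the larger lattice in which the basis vector [e_i] is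
    replaced by [e_i / ('X - x)]. Row [i] of the Gram matrix is divided by
    ['X - x] and column [i] by its conjugate; on the diagonal the two factors are
    coprime unless [x] is real, and then positivity provides a double root. *)
Lemma selfadj_divide q n (H A : 'M[{poly C}]_n) x i :
  selfadj q H A -> \det H != 0 ->
  (forall j, root (H i j) x) -> (forall j, j != i -> root (A i j) x) ->
  exists H1 A1 : 'M_n, [/\ selfadj q H1 A1, \det H1 != 0
    & (size (\det H1) < size (\det H))%N].
Proof.
move=> [Hh Hp HA qE] dH0 rH rA.
pose d j : {poly C} := if j == i then 'X - x%:P else 1.
have d0 j : d j != 0 by rewrite /d; case: ifP; rewrite ?polyXsubC_eq0 ?oner_neq0.
have sXx : star ('X - x%:P) = 'X - (x^*)%:P by rewrite rmorphB /= starX starC.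
have divH j k : d j * star (d k) %| H j k.
  have rH' l : 'X - (x^*)%:P %| H l i.
    rewrite -Hh adjmE -sXx; have := rH l; rewrite -dvdp_XsubCl => /dvdpP[g ->].
    by rewrite rmorphM dvdp_mull.
  rewrite /d; case: ifP => [/eqP->|_]; case: ifP => [/eqP->|_];
    rewrite ?rmorph1 ?mulr1 ?mul1r ?dvd1p ?dvdp_XsubCl ?sXx //.
  have [xR|xNR] := boolP (x \is Num.real).
    by rewrite (CrealP xR); apply: nonneg_double_root => //; apply: psd_diag.
  rewrite Gauss_dvdp ?dvdp_XsubCl ?rH -?dvdp_XsubCl ?rH' //.
  rewrite coprimep_XsubC root_XsubC; apply: contra xNR => /eqP xE.
  by apply/CrealP.
have divA j k : d j %| A j k * d k.
  rewrite /d; case: ifP => [/eqP->|_]; last by rewrite dvd1p.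
  case: ifP => [_|/negbT/rA]; first exact: dvdp_mull.
  by rewrite mulr1 dvdp_XsubCl.
pose H1 := \matrix_(j, k) (H j k %/ (d j * star (d k))).
pose A1 := \matrix_(j, k) ((A j k * d k) %/ d j).
pose D := diag_mx (\row_j d j).
have DE : D *m H1 *m adjm D = H.
  apply/matrixP => j k; rewrite /adjm tr_diag_mx map_diag_mx mul_mx_diag.
  by rewrite mul_diag_mx !mxE mulrAC mulrC divpK.
have AE : D *m A1 = A *m D.
  apply/matrixP => j k; rewrite mul_mx_diag mul_diag_mx !mxE.
  by rewrite mulrC divpK.
have detD : \det D = 'X - x%:P.
  rewrite det_diag (bigD1 i) //= big1 ?mulr1 => [|j ji].
    by rewrite mxE /d eqxx.
  by rewrite mxE /d (negbTE ji).
have dD0 : \det D != 0 by rewrite detD polyXsubC_eq0.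
have detE : \det H = (\det D * \det H1) * ('X - (x^*)%:P).
  by rewrite -DE !det_mulmx det_adjm detD sXx.
have dH1 : \det H1 != 0.
  by apply: contra dH0 => /eqP h; rewrite detE h mulr0 mul0r.
have canD (M N : 'M_n) : D *m M = D *m N -> M = N.
  move=> /(congr1 (mulmx (\adj D))).
  rewrite !mulmxA mul_adj_mx !mul_scalar_mx => /matrixP E.
  by apply/matrixP => j k; have := E j k; rewrite !mxE => /(mulfI dD0).
have canDr (M N : 'M_n) : M *m adjm D = N *m adjm D -> M = N.
  move=> /(congr1 (@adjm _ _ _)); rewrite !adjmM !adjmK => /canD.
  by move=> /(congr1 (@adjm _ _ _)); rewrite !adjmK.
exists H1, A1; split; [|exact: dH1|]; last first.
  rewrite detE detD size_Mmonic ?monicXsubC ?mulf_neq0 ?polyXsubC_eq0 //.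
  by rewrite size_XsubC addn2 /= size_monicM ?monicXsubC // size_XsubC add2n /= ltnW.
split.
- apply: canD; apply: canDr; rewrite DE -[RHS]Hh -[in RHS]DE.
  by rewrite !adjmM adjmK mulmxA.
- apply: psd_nonneg_const => v.
  (* Away from [x] the form is a congruent copy of the old one; the value at
     [x] follows by continuity. *)
  have Hy y (w : 'rV[C]_n) : y \is Num.real -> y != x ->
      0 <= (w *m evalm y H1 *m w^t*) 0 0.
    move=> yR yx; have uD : evalm y D \in unitmx.
      by rewrite unitmxE unitfE det_evalm detD hornerXsubC subr_eq0.
    have := Hp y yR (w *m invmx (evalm y D)).
    rewrite -DE !evalmM evalm_adjm // !mulmxA mulmxKV //.
    by rewrite -[_ *m _ *m _^t*]mulmxA -map_mxM -trmx_mul mulmxKV.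
  have Hy' y : y \is Num.real -> y != x ->
      0 <= ((map_mx polyC v *m H1 *m adjm (map_mx polyC v)) 0 0).[y].
    by move=> yR yx; rewrite -evalmE !evalmM evalm_adjm // evalm_const; apply: Hy.
  have [xR|xNR] := boolP (x \is Num.real); first exact: nonneg_punctured Hy'.
  by move=> y yR; apply: Hy' => //; apply: contraNneq xNR => <-.
- apply: canD; apply: canDr.
  have -> : D *m (A1 *m H1) *m adjm D = A *m H.
    by rewrite mulmxA AE -(mulmxA A) -(mulmxA A) DE.
  have -> : D *m (H1 *m adjm A1) *m adjm D = H *m adjm A.
    by rewrite -!mulmxA -adjmM AE adjmM !mulmxA DE.
  exact: HA.
- rewrite -qE; apply: (mulfI (x := (\det D)%:P)); first by rewrite polyC_eq0.
  rewrite -(det_map_mx (@polyC _) D) -det_mulmx mulrC -det_mulmx.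
  congr (\det _).
  by rewrite /char_poly_mx mulmxBl mulmxBr -!map_mxM AE scalar_mxC.
Qed.

Lemma selfadj_unimodular q n (H A : 'M[{poly C}]_n) :
  selfadj q H A -> \det H != 0 ->
  exists H1 A1 : 'M[{poly C}]_n, selfadj q H1 A1 /\ size (\det H1) = 1%N.
Proof.
have [k] := ubnP (size (\det H)); elim: k H A => // k IH H A ltk sHA dH.
have [s1|/closed_rootP[x rx]] := eqVneq (size (\det H)) 1%N; first by exists H, A.
have [i [H1 [A1 [sHA1 sd1 rH rA]]]] := selfadj_adapted sHA rx.
have dH1 : \det H1 != 0 by rewrite -size_poly_eq0 sd1 size_poly_eq0.
have [H2 [A2 [sHA2 dH2 sd2]]] := selfadj_divide sHA1 dH1 rH rA.
by apply: (IH H2 A2) => //; rewrite (leq_trans sd2) // sd1 -ltnS.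
Qed.

End LocalStep.

(** * Reduction at infinity *)

Lemma coefM_top (R : comNzRingType) (p q : {poly R}) a b :
  (size p <= a.+1)%N -> (size q <= b.+1)%N ->
  (size (p * q)%R <= (a + b).+1)%N /\ (p * q)`_(a + b) = p`_a * q`_b.
Proof.
move=> pa qb; split.
  apply: leq_trans (size_polyMleq _ _) _.
  by rewrite -subn1 leq_subLR add1n -addnS -addSn leq_add.
have la : (a < (a + b).+1)%N by rewrite ltnS leq_addr.
rewrite coefM (bigD1 (Ordinal la)) //= addKn big1 ?addr0 // => i ia.
have [lt|] := ltnP a i.
  by rewrite [p`_i]nth_default ?mul0r // (leq_trans pa).
rewrite leq_eqVlt => /predU1P[/eqP iE|lt]; first by rewrite -val_eqE /= iE in ia.
rewrite [q`_ _]nth_default ?mulr0 // (leq_trans qb) //.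
by rewrite ltn_subRL ltn_add2r.
Qed.

Lemma coef_prod_top (R : comNzRingType) (I : finType) (p : I -> {poly R}) m :
  (forall i, size (p i) <= (m i).+1)%N ->
  (\prod_i p i)`_(\sum_i m i) = \prod_i (p i)`_(m i).
Proof.
move=> pm; pose K (f : {poly R}) k c := (size f <= k.+1)%N /\ f`_k = c.
suff [] : K (\prod_i p i) (\sum_i m i)%N (\prod_i (p i)`_(m i)) by [].
apply: (big_rec3 K) => [|i c k f _ [sf <-]].
  by split; rewrite ?size_poly1 ?coef1.
by have [] := coefM_top (pm i) sf; split.
Qed.

Lemma det_coef_top (R : comNzRingType) n (M : 'M[{poly R}]_n) (m : 'I_n -> nat) :
  (forall i j, size (M i j) <= (m i + m j).+1)%N ->
  (\det M)`_(\sum_i m i + \sum_i m i) = \det (\matrix_(i, j) (M i j)`_(m i + m j)).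
Proof.
move=> bM; rewrite /determinant coef_sum; apply: eq_bigr => s _.
have -> : (\sum_i m i + \sum_i m i = \sum_i (m i + m (s i)))%N.
  by rewrite big_split /= [X in (_ + X)%N = _](reindex_inj (@perm_inj _ s)).
under [in RHS]eq_bigr do rewrite mxE.
have bs i : (size (M i (s i)) <= (m i + m (s i)).+1)%N by apply: bM.
rewrite -(coef_prod_top bs).
by rewrite !mulr_sign; case: (odd_perm s); rewrite ?coefN.
Qed.

Lemma size_drop_lead (R : nzSemiRingType) (p : {poly R}) k :
  (size p <= k.+1)%N -> p`_k = 0 -> (size p <= k)%N.
Proof.
move=> sp pk; apply/leq_sizeP => j; rewrite leq_eqVlt => /predU1P[<- //|kj].
by rewrite nth_default // (leq_trans sp).
Qed.

Section Infinity.
Variable C : numClosedFieldType.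

(** The numbers [m i] are half degrees of the basis vectors, and the matrix of the
    coefficients of degree [m i + m j] is the value of the Gram matrix at infinity.
    Given [v] in its kernel, replace the vector of largest degree in the support of
    [v] by the combination with coefficients [v_j 'X^(m i - m j)], in which the top
    degrees cancel. The new diagonal entry has degree less than [2 m i], hence at
    most [2 m i - 2] since it is nonnegative on the real line. *)
Lemma selfadj_lower_degree q n (H A : 'M[{poly C}]_n) (m : 'I_n -> nat) :
  selfadj q H A -> \det H != 0 ->
  (forall i j, size (H i j) <= (m i + m j).+1)%N ->
  \det (\matrix_(i, j) (H i j)`_(m i + m j)) = 0 ->
  exists (H1 A1 : 'M[{poly C}]_n) (m1 : 'I_n -> nat),
    [/\ selfadj q H1 A1, size (\det H1) = size (\det H),
        forall i j, (size (H1 i j) <= (m1 i + m1 j).+1)%N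
      & (\sum_i m1 i < \sum_i m i)%N].
Proof.
move=> sHA dH bH /eqP/det0P[v0 /rV0Pn[i0 v0i0] v0L].
case: (@arg_maxnP _ i0 (fun i => v0 0 i != 0) m v0i0) => i vi imax.
pose v := (v0 0 i)^-1 *: v0.
have v1 : v 0 i = 1 by rewrite mxE mulVf.
have mv j : v 0 j != 0 -> (m j <= m i)%N.
  by rewrite mxE mulf_eq0 negb_or => /andP[_ /imax].
have {v0L} vL j : \sum_k v 0 k * (H k j)`_(m k + m j) = 0.
  have /rowP/(_ j) : v *m \matrix_(i, j) (H i j)`_(m i + m j) = 0.
    by rewrite -scalemxAl v0L scaler0.
  rewrite !mxE => vL; rewrite -[RHS]vL.
  by apply: eq_bigr => k _; rewrite !mxE.
clearbody v; clear v0 v0i0 vi imax.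
pose w := \row_j (v 0 j *: 'X^(m i - m j)).
have [|P [P' [PP' Pi Pj]]] := @basis_with_row _ _ w i.
  by rewrite mxE v1 subnn scale1r.
have PE k j : P k j = if k == i then w 0 j else (k == j)%:R.
  case: eqP => [->|/eqP /Pj]; first by rewrite -Pi -rowE mxE.
  by rewrite -rowE => /rowP/(_ j); rewrite !mxE eqxx eq_sym.
pose H1 := P *m H *m adjm P.
have sHA1 : selfadj q H1 (P *m A *m P') by apply: selfadj_basis.
have sdH1 : size (\det H1) = size (\det H) by apply: size_det_basis PP'.
have [H1h H1p _ _] := sHA1.
pose G := P *m H.
have GE k j : k != i -> G k j = H k j.
  move=> ki; rewrite mxE (bigD1 k) //= PE (negbTE ki) eqxx mul1r big1 ?addr0 //.
  by move=> l lk; rewrite PE (negbTE ki) eq_sym (negbTE lk) mul0r.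
have sG j : (size (G i j) <= m i + m j)%N.
  have sk k : (size (P i k * H k j)%R <= (m i + m j).+1)%N /\
       (P i k * H k j)`_(m i + m j) = v 0 k * (H k j)`_(m k + m j).
    rewrite PE eqxx mxE; have [->|vk] := eqVneq (v 0 k) 0.
      by rewrite scale0r !mul0r size_poly0 coef0.
    rewrite -scalerAl coefZ.
    have [|sk ck] := @coefM_top _ 'X^(m i - m k) (H k j) (m i - m k) _ _ (bH k j).
      by rewrite size_polyXn.
    rewrite addnA subnK ?mv // in sk ck; split.
      by apply: leq_trans (size_scale_leq _ _) _.
    by rewrite ck coefXn eqxx mul1r.
  apply: size_drop_lead; rewrite mxE.
    by apply: (leq_trans (size_sum _ _ _)); apply/bigmax_leqP => k _; have [] := sk k.
  by rewrite coef_sum -[RHS](vL j); apply: eq_bigr => k _; have [] := sk k.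
have H1E k j : j != i -> H1 k j = G k j.
  move=> ji; rewrite mxE (bigD1 j) //= adjmE PE (negbTE ji) eqxx rmorph1 mulr1.
  rewrite big1 ?addr0 // => l lj.
  by rewrite adjmE PE (negbTE ji) eq_sym (negbTE lj) rmorph0 mulr0.
have sii : (size (H1 i i) <= m i + m i)%N.
  rewrite mxE; apply: (leq_trans (size_sum _ _ _)); apply/bigmax_leqP => k _.
  rewrite adjmE PE eqxx [w 0 k]mxE.
  have [->|vk] := eqVneq (v 0 k) 0; first by rewrite scale0r rmorph0 mulr0 size_poly0.
  apply: leq_trans (size_polyMleq _ _) _; rewrite size_star size_scale // size_polyXn.
  rewrite addnS /=; apply: leq_trans (leq_add (sG k) (leqnn _)) _.
  by rewrite -addnA subnKC ?mv.
(* If [m i = 0] the new vector is isotropic, so the form is degenerate. *)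
have [mi0|mi0] := posnP (m i).
  have H10 : H1 i i = 0 by apply/eqP; rewrite -size_poly_leq0 (leq_trans sii) // mi0.
  suff dH10 : \det H1 = 0.
    by move: dH; rewrite -size_poly_eq0 -sdH1 dH10 size_poly0.
  apply/eqP/det0P; exists 'e_i.
    by apply/eqP => /rowP/(_ i); rewrite !mxE !eqxx => /eqP; rewrite oner_eq0.
  rewrite -rowE; apply/rowP => j; rewrite [LHS]mxE [RHS]mxE.
  exact: psd_diag0.
have {}sii : (size (H1 i i) <= (m i).-1 + m i)%N.
  apply: size_drop_lead; first by rewrite -addSn prednK.
  apply: nonneg_odd; last exact: psd_diag.
    by rewrite -[X in (_ + X)%N](prednK mi0) addnS /= oddD addbb.
  by rewrite -addSn prednK.
pose m1 j := if j == i then (m i).-1 else m j.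
have sr j : j != i -> (size (H1 i j) <= (m1 i + m1 j).+1)%N.
  by move=> ji; rewrite /m1 eqxx (negbTE ji) H1E // -addSn prednK.
exists H1, (P *m A *m P'), m1; split=> // [k j|].
  have [ki|ki] := eqVneq k i; have [ji|ji] := eqVneq j i; rewrite ?ki ?ji.
  - by rewrite /m1 eqxx -addnS prednK.
  - exact: sr.
  - by rewrite -H1h adjmE size_star addnC sr.
  - by rewrite /m1 (negbTE ki) (negbTE ji) H1E // GE.
rewrite (bigD1 i) // [X in (_ < X)%N](bigD1 i) //= /m1 eqxx.
rewrite (eq_bigr m) => [|j /negbTE-> //].
by rewrite ltn_add2r prednK.
Qed.

(** Once the form is nondegenerate at infinity, twice the sum of the half degrees is
    the degree of the determinant. *)
Lemma selfadj_constant q n (H A : 'M[{poly C}]_n) :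
  selfadj q H A -> size (\det H) = 1%N ->
  exists (H0 : 'M[C]_n) A1, selfadj q (map_mx polyC H0) A1 /\ \det H0 != 0.
Proof.
have [m bH] : exists m : 'I_n -> nat,
    forall i j, (size (H i j) <= (m i + m j).+1)%N.
  exists (fun=> \max_i \max_j size (H i j))%N => i j.
  apply: leq_trans (leqW (leq_addr _ _)).
  by apply: leq_trans (leq_bigmax i); apply: leq_trans (leq_bigmax j).
have [k] := ubnP (\sum_i m i).
elim: k H A m bH => // k IH H A m bH ltk sHA sd.
have dH : \det H != 0 by rewrite -size_poly_eq0 sd.
have [dL|dL] := eqVneq (\det (\matrix_(i, j) (H i j)`_(m i + m j))) 0.
  have [H1 [A1 [m1 [sHA1 sd1 b1 lt1]]]] := selfadj_lower_degree sHA dH bH dL.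
  by apply: (IH H1 A1 m1); rewrite ?(leq_trans lt1) // sd1.
have m0' i : m i = 0%N.
  have : (\sum_i m i + \sum_i m i < size (\det H))%N.
    by rewrite ltnNge; apply: contra dL => /(nth_default 0) h; rewrite -det_coef_top // h.
  rewrite sd ltnS leqn0 addn_eq0 sum_nat_eq0 andbb => /forallP/(_ i).
  by move/eqP.
have HE : H = map_mx polyC (\matrix_(i, j) (H i j)`_0).
  apply/matrixP => i j; rewrite !mxE -size1_polyC //.
  by have := bH i j; rewrite !m0'.
exists (\matrix_(i, j) (H i j)`_0), A; rewrite -HE; split => //.
apply: contra dH => /eqP d0; by rewrite HE det_map_mx d0.
Qed.

End Infinity.

(** * Hermitian polynomial matrices of linear growth *)

Section ConstantGram.
Variable C : numClosedFieldType.

(** Polynomials in [t] with coefficients in [C[y]] are represented by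
    [{poly {poly C}}]; the inner variable [y] is specialized. *)
Definition fiber (y : C) (q : {poly {poly C}}) : {poly C} :=
  map_poly (horner_eval y) q.
HB.instance Definition _ y :=
  GRing.RMorphism.copy (fiber y) (map_poly (horner_eval y)).

Lemma coef_fiber y q i : (fiber y q)`_i = (q`_i).[y].
Proof. by rewrite coef_map. Qed.

Lemma fiber_char_poly y n (A : 'M[{poly C}]_n) :
  fiber y (char_poly A) = char_poly (evalm y A).
Proof. exact: map_char_poly. Qed.

Lemma hermsymmxE n (A : 'M[C]_n) : (A \is hermsymmx) = (A^t* == A).
Proof. by rewrite is_hermitianmxE expr0 scale1r eq_sym. Qed.

Lemma herm_spectral n (A : 'M[C]_n) : A^t* = A ->
  exists U (d : 'rV_n), U \is unitarymx /\ A = U^t* *m diag_mx d *m U.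
Proof.
move=> /eqP; rewrite -hermsymmxE => /hermitian_normalmx/orthomx_spectralP AE.
exists (spectralmx A), (spectral_diag A); split; first exact: spectral_unitarymx.
by rewrite -invmx_unitary ?spectral_unitarymx.
Qed.

Lemma posdef_congr1 n (H : 'M[C]_n) :
  H^t* = H -> (forall v : 'rV_n, 0 <= (v *m H *m v^t*) 0 0) -> \det H != 0 ->
  exists2 P, P \in unitmx & P *m H *m P^t* = 1%:M.
Proof.
move=> Hh Hp dH; have [U [d [Uu HE]]] := herm_spectral Hh.
have UU : U *m U^t* = 1%:M by apply/unitarymxP.
have dE : U *m H *m U^t* = diag_mx d.
  by rewrite HE !mulmxA UU mul1mx -mulmxA UU mulmx1.
have d_gt0 i : 0 < d 0 i.
  rewrite lt0r; apply/andP; split.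
    apply: contra dH => /eqP di; rewrite HE !det_mulmx det_diag.
    by rewrite (bigD1 i) //= di mul0r mulr0 mul0r.
  have := Hp ('e_i *m U).
  rewrite trmx_mul map_mxM !mulmxA -(mulmxA _ U H) -(mulmxA _ (U *m H)) dE.
  rewrite -rowE (_ : _^t* = delta_mx i 0) -?colE.
    by rewrite !mxE eqxx mulr1n.
  by apply/matrixP => a b; rewrite !mxE rmorph_nat andbC.
pose S := diag_mx (\row_i (sqrtC (d 0 i))^-1).
have s0 i : sqrtC (d 0 i) != 0 by rewrite sqrtC_eq0 gt_eqF.
exists (S *m U).
  rewrite unitmx_mul (unitarymx_unit Uu) andbT unitmxE unitfE det_diag.
  by apply/prodf_neq0 => i _; rewrite mxE invr_eq0.
rewrite trmx_mul map_mxM !mulmxA -(mulmxA S U H) -(mulmxA S (U *m H)) dE.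
rewrite tr_diag_mx map_diag_mx -mulmxA mulmx_diag mulmx_diag -diag_const_mx.
congr diag_mx; apply/rowP => i; rewrite !mxE /= geC0_conj; last first.
  by rewrite invr_ge0 sqrtC_ge0 ltW.
by rewrite -[X in _ * (X * _)]sqrtCK expr2 mulfK ?mulVf.
Qed.

(** In an orthonormal basis for the constant form, self-adjoint means Hermitian. *)
Lemma selfadj_hermitian q n (H0 : 'M[C]_n) A :
  selfadj q (map_mx polyC H0) A -> \det H0 != 0 ->
  exists2 A1 : 'M[{poly C}]_n, adjm A1 = A1 & char_poly A1 = q.
Proof.
move=> sHA dH0; have [Hh Hp _ _] := sHA.
have [||P Pu PH] := @posdef_congr1 _ H0 _ _ dH0.
- by rewrite -[RHS](evalm_const 0) -Hh evalm_adjm ?real0 // evalm_const.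
- by move=> v; have := Hp 0 (real0 _) v; rewrite evalm_const.
pose Q : 'M_n := map_mx polyC P; pose Q' : 'M_n := map_mx polyC (invmx P).
have QQ' : Q *m Q' = 1%:M by rewrite /Q /Q' -map_mxM mulmxV // map_mx1.
have [_ _ + qE] := selfadj_basis QQ' sHA.
have -> : Q *m map_mx polyC H0 *m adjm Q = 1%:M.
  have -> : adjm Q = map_mx polyC (P^t*).
    by apply/matrixP => i j; rewrite adjmE !mxE starC.
  by rewrite -!map_mxM PH map_mx1.
by rewrite mulmx1 mul1mx => HA; exists (Q *m A *m Q').
Qed.

Definition linear_growth (q : {poly {poly C}}) :=
  exists2 K, 0 <= K & forall y t : C, y \is Num.real -> root (fiber y q) t ->
    `|t| <= K * (1 + `|y|).

(** Otherwise [2 K^2 (1 + y^2) - |p(y)|^2] would be a nonnegative polynomial with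
    negative leading coefficient. *)
Lemma size_linear_growth (p : {poly C}) K : 0 <= K ->
  (forall y, y \is Num.real -> `|p.[y]| <= K * (1 + `|y|)) -> (size p <= 2)%N.
Proof.
move=> K0 Hp; rewrite leqNgt; apply/negP => sp.
pose k := (size p).-1; have kE : size p = k.+1 by rewrite prednK // ltnW // ltnW.
pose g := (2 * K ^+ 2)%:P * (1%:P + 'X^2) - p * star p.
have g0 : nonneg g.
  move=> y yR; rewrite hornerD hornerN !hornerM !hornerD !hornerC hornerXn.
  rewrite horner_star_real // -normCK subr_ge0.
  apply: le_trans (_ : (K * (1 + `|y|)) ^+ 2 <= _).
    by rewrite lerXn2r ?nnegrE ?mulr_ge0 ?addr_ge0 ?normr_ge0 ?ler01 ?Hp.
  rewrite exprMn [leRHS](_ : _ = K ^+ 2 * (2 * (1 + y ^+ 2))); last by ring.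
  rewrite ler_wpM2l ?exprn_ge0 //.
  rewrite -(real_normK yR) -subr_ge0.
  rewrite (_ : _ - _ = (1 - `|y|) ^+ 2); last by ring.
  by rewrite real_exprn_even_ge0 // realB ?real1 ?normr_real.
have [||spp cpp] := @coefM_top _ p (star p) k k; rewrite ?size_star ?kE //.
have k1 : (1 < k)%N by rewrite -ltnS -kE.
have s3 : (size ((2 * K ^+ 2)%:P * (1%:P + 'X^2))%R <= 3)%N.
  rewrite mul_polyC (leq_trans (size_scale_leq _ _)) //.
  by rewrite addrC size_polyDl size_polyXn ?size_polyC ?oner_neq0.
have k3 : (3 <= k + k)%N by lia.
have sg : (size g <= (k + k).+1)%N.
  rewrite (leq_trans (size_polyD _ _)) // geq_max size_polyN spp andbT.
  by rewrite (leq_trans s3) // leqW.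
have := nonneg_lead sg g0.
rewrite coefB nth_default ?(leq_trans s3) // sub0r cpp star_coef -normCK oppr_ge0.
rewrite -[p`_k]/(lead_coef p) => lp.
have : `|lead_coef p| ^+ 2 == 0 by rewrite eq_le lp exprn_ge0.
by rewrite expf_eq0 /= normr_eq0 lead_coef_eq0 -size_poly_eq0 kE.
Qed.

(** In the spectral decomposition [A = U^* D U] the entries of [U] have modulus at
    most 1, and those of [D] are eigenvalues. *)
Lemma hermitian_entry_bound n (A : 'M[C]_n) K : 0 <= K -> A^t* = A ->
  (forall t, root (char_poly A) t -> `|t| <= K) ->
  forall i j, `|A i j| <= K *+ n.
Proof.
move=> K0 Ah AK i j; have [U [d [Uu AE]]] := herm_spectral Ah.
have UU : U *m U^t* = 1%:M by apply/unitarymxP.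
have dK k : `|d 0 k| <= K.
  apply: AK; rewrite AE char_poly_similar ?(mulmx1C UU) //.
  rewrite (char_poly_trig (diag_mx_is_trig d)) rootE horner_prod.
  by rewrite (bigD1 k) //= !hornerE mxE eqxx mulr1n subrr mul0r.
have U1 k l : `|U k l| <= 1.
  have /matrixP/(_ k k) := UU; rewrite !mxE eqxx => U1.
  rewrite -(@expr_le1 _ 2) // -[X in _ <= X]U1 (bigD1 l) //= !mxE -normCK.
  by rewrite lerDl sumr_ge0 // => m _; rewrite !mxE -normCK exprn_ge0.
rewrite AE mxE; apply: le_trans (ler_norm_sum _ _ _) _.
rewrite -[n in K *+ n]card_ord -sumr_const; apply: ler_sum => k _.
rewrite mul_mx_diag !mxE !normrM norm_conjC mulrAC.
by rewrite -[K]mul1r ler_pM ?mulr_ge0 ?normr_ge0 ?dK ?mulr_ile1 ?normr_ge0 ?U1.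
Qed.

Lemma hermitian_linear q n (A : 'M[{poly C}]_n) :
  adjm A = A -> char_poly A = q -> linear_growth q ->
  exists A0 A1 : 'M[C]_n, [/\ A0^t* = A0, A1^t* = A1
    & char_poly (map_mx polyC A0 + 'X *: map_mx polyC A1) = q].
Proof.
move=> Ah qE [K K0 HK].
have sA i j : (size (A i j) <= 2)%N.
  apply: (@size_linear_growth _ (K *+ n)); first exact: mulrn_wge0.
  move=> y yR; rewrite -evalmE mulrnAl.
  apply: hermitian_entry_bound; rewrite -?evalm_adjm ?Ah //.
    by rewrite mulr_ge0 ?addr_ge0 ?ler01.
  by move=> t; rewrite -fiber_char_poly qE; apply: HK.
have herm k : (\matrix_(i, j) (A i j)`_k)^t* = \matrix_(i, j) (A i j)`_k.
  by apply/matrixP => i j; rewrite !mxE -{2}Ah adjmE star_coef.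
exists (\matrix_(i, j) (A i j)`_0), (\matrix_(i, j) (A i j)`_1).
split; [exact: herm | exact: herm |].
rewrite -[RHS]qE; congr char_poly; apply/matrixP => i j; rewrite !mxE.
apply/polyP => k; rewrite coefD coefXM !coefC.
by case: k => [|[|k]] /=; rewrite ?addr0 ?add0r // nth_default // (leq_trans (sA i j)).
Qed.

End ConstantGram.

(** * Powers of a matrix and factorization of monic polynomials *)

Lemma trig_mulmx (R : pzRingType) n (A B : 'M[R]_n) :
  is_trig_mx A -> is_trig_mx B ->
  is_trig_mx (A *m B) /\ forall i, (A *m B) i i = A i i * B i i.
Proof.
move=> /is_trig_mxP At /is_trig_mxP Bt; split => [|i].
  apply/is_trig_mxP => i j ij; rewrite mxE big1 // => k _.
  have [ik|ki] := ltnP i k; first by rewrite At ?mul0r.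
  by rewrite Bt ?mulr0 // (leq_ltn_trans ki).
rewrite mxE (bigD1 i) //= big1 ?addr0 // => k; rewrite neq_ltn => /orP[ki|ik].
  by rewrite Bt ?mulr0.
by rewrite At ?mul0r.
Qed.

Lemma trace_powers (C : numClosedFieldType) n (A : 'M[C]_n.+1) :
  exists2 r : 'I_n.+1 -> C, char_poly A = \prod_i ('X - (r i)%:P)
    & forall k, \tr (A ^+ k) = \sum_i r i ^+ k.
Proof.
have [P Pu] := Schur A (ltn0Sn n); rewrite /similar_to /=.
have Pi := unitarymx_unit Pu; rewrite conjumx // => Tt.
set T := P *m A *m invmx P in Tt.
exists (fun i => T i i) => [|k].
  by rewrite -(char_poly_trig Tt) char_poly_similar // mulmxV.
have [Tk Tkk] : is_trig_mx (T ^+ k) /\ forall i, (T ^+ k) i i = T i i ^+ k.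
  elim: k => [|k [IHt IHd]].
    split=> [|i]; first exact: scalar_mx_is_trig.
    by rewrite !expr0 mxE eqxx.
  rewrite exprS; have [t d] := trig_mulmx Tt IHt; split=> // i.
  by rewrite -[_ * _]/(T *m T ^+ k) d IHd exprS.
rewrite -(eq_bigr _ (fun i _ => Tkk i)).
have -> : T ^+ k = P *m A ^+ k *m invmx P.
  elim: (k) => [|l IH]; first by rewrite !expr0 mulmx1 mulmxV.
  by rewrite exprS IH -mulmxE /T !mulmxA mulmxKV // exprS -mulmxE !mulmxA.
by rewrite -/(mxtrace _) mxtrace_mulC mulmxA mulVmx // mul1mx.
Qed.

(** The companion matrix of [q] is the operator of multiplication by [t] on the
    quotient by [q]. The second conclusion says that multiplication by [t] sends
    [t^i] to the combination of powers read off row [i], the last row being the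
    theorem of Cayley and Hamilton. *)
Lemma companion_matrix (R : comNzRingType) (q : {poly R}) n : q \is monic ->
  size q = n.+2 ->
  exists2 A : 'M[R]_n.+1, char_poly A = q
    & forall i : 'I_n.+1, \sum_k A i k *: A ^+ k = A ^+ i.+1.
Proof.
move=> qm sq; have companion m : (size q).-1 = m -> exists A : 'M[R]_m, char_poly A = q /\
    forall i j, A i j = if i == m.-1 :> nat then - q`_j else (i.+1 == j :> nat)%:R.
  case: m /; exists (companionmx q); split; first exact: companionmxK.
  by move=> i j; rewrite mxE.
have [|A [qE /= AE]] := companion n.+1; first by rewrite sq.
exists A => // i; have [iE|iN] := eqVneq (i : nat) n; last first.
  have lti : (i.+1 < n.+1)%N by rewrite ltnS ltn_neqAle iN -ltnS ltn_ord.
  rewrite (bigD1 (Ordinal lti)) //= AE (negbTE iN) eqxx scale1r big1 ?addr0 //.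
  move=> k ki; rewrite AE (negbTE iN) (_ : (_ == _) = false) ?scale0r //.
  by apply: contraNF ki => /eqP e; apply/eqP/val_inj.
have := Cayley_Hamilton A; rewrite qE.
rewrite -[q in horner_mx A q]coefK poly_def linear_sum sq big_ord_recr /=.
have -> : q`_n.+1 = 1 by move/monicP: qm; rewrite lead_coefE sq.
rewrite scale1r rmorphXn /= horner_mx_X iE => /eqP.
rewrite addrC addr_eq0 => /eqP ->; rewrite -sumrN; apply: eq_bigr => k _.
by rewrite AE iE eqxx scaleNr horner_mxZ rmorphXn /= horner_mx_X.
Qed.

Section Factorization.
Variable C : numClosedFieldType.

Lemma fiber_eq0 x (g : {poly {poly C}}) : fiber x g = 0 ->
  exists g', g = ('X - x%:P) *: g'.
Proof.
move=> gx; exists (\poly_(i < size g) (g`_i %/ ('X - x%:P))).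
apply/polyP => i; rewrite coefZ coef_poly; case: ltnP => [_|?]; last first.
  by rewrite nth_default ?mulr0.
by rewrite mulrC divpK // dvdp_XsubCl rootE -coef_fiber gx coef0.
Qed.

(** Gauss's lemma, by induction on the degree of the common denominator [c]: at a
    root [x] of [c] the fiber of [g] or that of [h] vanishes, so ['X - x] divides
    all the coefficients of one of them and cancels. *)
Lemma gauss_monic (q g h : {poly {poly C}}) (c : {poly C}) :
  q \is monic -> c != 0 -> c *: q = g * h ->
  exists g1 h1 : {poly {poly C}},
    [/\ g1 \is monic, h1 \is monic, q = g1 * h1 & size g1 = size g].
Proof.
move=> qm; have [k] := ubnP (size c); elim: k c g h => // k IH c g h ltk c0 cq.
have lc : lead_coef g * lead_coef h = c.
  by rewrite -lead_coefM -cq lead_coefZ (monicP qm) mulr1.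
have g0 : g != 0 by apply: contra c0 => /eqP g0; rewrite -lc g0 lead_coef0 mul0r.
have h0 : h != 0 by apply: contra c0 => /eqP h0; rewrite -lc h0 lead_coef0 mulr0.
have [s1|/closed_rootP[x rx]] := eqVneq (size c) 1%N.
  have : size (lead_coef g) = 1%N /\ size (lead_coef h) = 1%N.
    have := congr1 (fun p : {poly C} => size p) lc.
    have : (0 < size (lead_coef g))%N by rewrite size_poly_gt0 lead_coef_eq0.
    have : (0 < size (lead_coef h))%N by rewrite size_poly_gt0 lead_coef_eq0.
    rewrite /= s1 size_mul ?lead_coef_eq0 //.
    by move: (size _) (size _) => a b; lia.
  case=> /eqP/size_poly1P[a a0 ga] /eqP/size_poly1P[b b0 hb].
  have cE : c = (a * b)%:P by rewrite -lc ga hb polyCM.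
  exists ((a^-1)%:P *: g), ((b^-1)%:P *: h); split.
  - by rewrite monicE lead_coefZ ga -polyCM mulVf.
  - by rewrite monicE lead_coefZ hb -polyCM mulVf.
  - rewrite -scalerAl -scalerAr -cq !scalerA cE -!polyCM.
    by rewrite mulrACA !mulVf // mulr1 scale1r.
  - by rewrite size_scale // polyC_eq0 invr_eq0.
have [c' cE] := factor_theorem _ _ rx.
have c'0 : c' != 0 by apply: contra c0 => /eqP c'0; rewrite cE c'0 mul0r.
have sc' : (size c' < k)%N.
  by move: ltk; rewrite cE size_Mmonic ?monicXsubC // size_XsubC addn2.
have x0 : 'X - x%:P != 0 :> {poly C} by rewrite polyXsubC_eq0.
have canx (a b : {poly {poly C}}) : ('X - x%:P) *: a = ('X - x%:P) *: b -> a = b.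
  by rewrite -!mul_polyC; apply: mulfI; rewrite polyC_eq0.
have : fiber x g * fiber x h == 0.
  rewrite -rmorphM -cq; apply/eqP/polyP => i.
  by rewrite coef_fiber coefZ hornerM (rootP rx) mul0r coef0.
rewrite mulf_eq0 => /orP[] /eqP /fiber_eq0[p pE].
  have cq' : c' *: q = p * h.
    by apply: canx; rewrite scalerA mulrC -cE cq pE scalerAl.
  have [g1 [h1 [? ? ? sg1]]] := IH _ _ _ sc' c'0 cq'.
  by exists g1, h1; split=> //; rewrite sg1 pE size_scale.
have cq' : c' *: q = g * p.
  by apply: canx; rewrite scalerA mulrC -cE cq pE scalerAr.
exact: IH sc' c'0 cq'.
Qed.

End Factorization.

(** * Real-rooted families are pencils of Hermitian matrices *)

Section Determinantal.
Variable C : numClosedFieldType.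

Definition real_rooted (q : {poly {poly C}}) :=
  forall y t : C, y \is Num.real -> root (fiber y q) t -> t \is Num.real.

Lemma evalmX n y (A : 'M[{poly C}]_n.+1) k : evalm y (A ^+ k) = evalm y A ^+ k.
Proof.
elim: k => [|k IH]; first by rewrite !expr0 /evalm map_mx1.
by rewrite !exprS -IH; apply: evalmM.
Qed.

(** The Gram matrix of [(a, b) |-> tr (a b)] in the basis of powers of [A]. *)
Definition trace_form n (A : 'M[{poly C}]_n.+1) : 'M[{poly C}]_n.+1 :=
  \matrix_(i, j) \tr (A ^+ (i + j)).

Lemma horner_trace n (A : 'M[{poly C}]_n.+1) y k :
  (\tr (A ^+ k)).[y] = \tr (evalm y A ^+ k).
Proof. by rewrite -evalmX trace_map_mx. Qed.

(** The trace of a power is the sum of the powers of the roots [r l], so the trace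
    form adds up the squared moduli of the values of the polynomial [u] at these
    roots; that they are real makes this a Hermitian square. *)
Lemma trace_form_roots q n (A : 'M[{poly C}]_n.+1) y :
  char_poly A = q -> real_rooted q -> y \is Num.real ->
  exists r : 'I_n.+1 -> C,
  [/\ forall l, r l \is Num.real, forall l, root (fiber y q) (r l),
     forall k, (\tr (A ^+ k)).[y] = \sum_l r l ^+ k
   & forall u : 'rV_n.+1, (u *m evalm y (trace_form A) *m u^t*) 0 0 =
       \sum_l `|\sum_i u 0 i * r l ^+ i| ^+ 2].
Proof.
move=> qE qr yR; have [r qyE trE] := trace_powers (evalm y A).
have rootr l : root (fiber y q) (r l).
  rewrite -qE fiber_char_poly qyE rootE horner_prod (bigD1 l) //= !hornerE.
  by rewrite subrr mul0r.
have rR l : r l \is Num.real by apply: qr (rootr l).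
exists r; split => // [k|u]; first by rewrite horner_trace trE.
transitivity (\sum_i \sum_j \sum_l (u 0 i * r l ^+ i) * (u 0 j * r l ^+ j)^*).
  rewrite mxE exchange_big /=; apply: eq_bigr => j _.
  rewrite mxE mulr_suml; apply: eq_bigr => i _.
  rewrite !mxE /horner_eval horner_trace trE mulr_sumr mulr_suml.
  apply: eq_bigr => l _; rewrite rmorphM rmorphXn /= (CrealP (rR l)) exprD.
  by rewrite -!mulrA; congr (_ * (_ * _)); rewrite mulrC.
under eq_bigr do rewrite exchange_big /=.
rewrite exchange_big /=; apply: eq_bigr => l _.
by rewrite normCK rmorph_sum mulr_suml; apply: eq_bigr => i _; rewrite mulr_sumr.
Qed.

(** The form only depends on the product of its arguments, which makes the
    multiplication by [t] self-adjoint. *)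
Lemma selfadj_trace q n (A : 'M[{poly C}]_n.+1) :
  char_poly A = q -> real_rooted q ->
  (forall i : 'I_n.+1, \sum_k A i k *: A ^+ k = A ^+ i.+1) ->
  selfadj q (trace_form A) A.
Proof.
move=> qE qr AE.
have trR k : star (\tr (A ^+ k)) = \tr (A ^+ k).
  apply/eqP; rewrite -subr_eq0; apply/eqP/poly_real_eq0 => y yR.
  rewrite hornerD hornerN horner_star_real //.
  have [r [rR _ -> _]] := trace_form_roots qE qr yR.
  rewrite rmorph_sum /= -sumrB big1 // => l _.
  by rewrite rmorphXn /= (CrealP (rR l)) subrr.
have Hh : adjm (trace_form A) = trace_form A.
  by apply/matrixP => i j; rewrite adjmE !mxE trR addnC.
have AHE i j : (A *m trace_form A) i j = \tr (A ^+ (i + j).+1).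
  rewrite mxE; under eq_bigr do rewrite mxE.
  rewrite -addSn exprD -AE mulr_suml raddf_sum; apply: eq_bigr => k _ /=.
  by rewrite -scalerAl linearZ -exprD.
split=> //.
- move=> y yR v; have [r [_ _ _ ->]] := trace_form_roots qE qr yR.
  by rewrite sumr_ge0 // => l _; rewrite exprn_ge0.
- rewrite -[in RHS]Hh -adjmM; apply/matrixP => i j.
  by rewrite adjmE !AHE trR addnC.
Qed.

(** A null vector [v] is a polynomial [p] of degree at most [n] that vanishes at the
    roots of every real fiber of [q]. A Bezout relation between [p] and [q] would
    then give a nonzero polynomial in [y] that vanishes on the real line, so the
    greatest common divisor of [p] and [q] is a proper factor of [q]. *)
Lemma trace_form_degenerate q n (A : 'M[{poly C}]_n.+1) :
  q \is monic -> char_poly A = q -> real_rooted q -> \det (trace_form A) = 0 ->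
  exists g h : {poly {poly C}},
    [/\ g \is monic, h \is monic, q = g * h & (1 < size g <= n.+1)%N].
Proof.
move=> qm qE qr /eqP/det0P[v v0 vT].
have sq : size q = n.+2 by rewrite -qE size_char_poly.
pose p : {poly {poly C}} := rVpoly v.
have p0 : p != 0.
  by apply: contra v0 => /eqP p0; rewrite -(rVpolyK v) -/p p0 linear0.
have sp : (size p <= n.+1)%N by apply: size_poly.
have q0 : q != 0 by rewrite monic_neq0.
have pr y : y \is Num.real -> exists2 t, root (fiber y q) t & root (fiber y p) t.
  move=> yR; have [r [rR rq _ rT]] := trace_form_roots qE qr yR.
  exists (r ord0); first exact: rq.
  have /eqP := rT (evalm y v).
  rewrite -evalmM vT (_ : evalm y 0 = 0) ?mul0mx ?mxE; last first.
    by apply/matrixP => i j; rewrite !mxE /horner_eval horner0.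
  rewrite eq_sym psumr_eq0 => [/allP/(_ ord0)|l _]; last by rewrite exprn_ge0.
  rewrite mem_index_enum => /(_ isT) /=; rewrite expf_eq0 /= normr_eq0 => /eqP E.
  rewrite rootE (@horner_coef_wide _ n.+1); last first.
    by rewrite (leq_trans (size_poly _ _)) // sp.
  apply/eqP; rewrite -[RHS]E; apply: eq_bigr => i _.
  by rewrite coef_fiber coef_rVpoly_ord mxE.
have ncop : ~~ coprimep p q.
  apply/negP => /Bezout_coprimepP[[u w] /=].
  rewrite -size_poly_eq1 => /size_poly1P[c c0 uE].
  have : c = 0; last by move/eqP; rewrite (negbTE c0).
  apply: poly_real_eq0 => y yR; have [t tq tp] := pr y yR.
  have := congr1 (fun f => (fiber y f).[t]) uE.
  rewrite rmorphD !rmorphM hornerD !hornerM (rootP tq) (rootP tp) !mulr0 addr0.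
  by rewrite /fiber map_polyC hornerC.
have := dvdp_gcdr p q => /Pdiv.Idomain.dvdpP[[c h] /= c0 cq].
rewrite mulrC in cq.
have [g1 [h1 [g1m h1m qE1 sg1]]] := gauss_monic qm c0 cq.
exists g1, h1; split=> //; rewrite sg1 ltn_neqAle eq_sym.
rewrite coprimep_def in ncop; rewrite ncop size_poly_gt0 gcdp_eq0 negb_and p0 /=.
exact: leq_trans (leq_gcdpl _ p0) sp.
Qed.

(** If the trace form is degenerate, [q] is a product, the hypotheses pass to the
    factors and the matrices are block diagonal. Otherwise the form is improved
    successively to a constant determinant, to a constant form, and to the identity. *)
Lemma real_rooted_pencil (q : {poly {poly C}}) :
  q \is monic -> real_rooted q -> linear_growth q ->
  exists n (A0 A1 : 'M[C]_n), [/\ A0^t* = A0, A1^t* = A1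
    & char_poly (map_mx polyC A0 + 'X *: map_mx polyC A1) = q].
Proof.
have [k] := ubnP (size q); elim: k q => // k IH q ltk qm qr qg.
have q0 := monic_neq0 qm.
case sq: (size q) (size_poly_gt0 q) => [|[|n]] qs; first by rewrite q0 in qs.
  exists 0%N, 0, 0; split; try by apply/matrixP => -[].
  rewrite /char_poly det_mx00.
  have /size_poly1P[c c0 qE] : size q == 1%N by rewrite sq.
  by have := qm; rewrite qE monicE lead_coefC => /eqP ->.
have [A qE AE] := companion_matrix qm sq.
have sHA := selfadj_trace qE qr AE.
have [dT|dT] := eqVneq (\det (trace_form A)) 0; last first.
  have [H1 [A1 [sHA1 sd1]]] := selfadj_unimodular sHA dT.
  have [H2 [A2 [sHA2 dH2]]] := selfadj_constant sHA1 sd1.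
  have [A3 A3h A3q] := selfadj_hermitian sHA2 dH2.
  by have [A4 [A5 ?]] := hermitian_linear A3h A3q qg; exists n.+1, A4, A5.
have [g [h [gm hm qgh /andP[g1 gn]]]] := trace_form_degenerate qm qE qr dT.
have sgh : (size g + size h = n.+3)%N.
  have := sq; rewrite qgh size_monicM ?monic_neq0 //.
  by move: (size g) (size h) g1 => a b; lia.
have fib y t : root (fiber y g) t || root (fiber y h) t -> root (fiber y q) t.
  by rewrite qgh rmorphM rootM.
have [K K0 HK] := qg.
have [||||a [B0 [B1 [B0h B1h gE]]]] := IH g => //.
- by move: ltk; rewrite sq; lia.
- by move=> y t yR rt; apply: (qr y) => //; apply: fib; rewrite rt.
- by exists K => // y t yR rt; apply: HK => //; apply: fib; rewrite rt.
have [||||b [D0 [D1 [D0h D1h hE]]]] := IH h => //.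
- by move: ltk; rewrite sq; lia.
- by move=> y t yR rt; apply: (qr y) => //; apply: fib; rewrite rt orbT.
- by exists K => // y t yR rt; apply: HK => //; apply: fib; rewrite rt orbT.
exists (a + b)%N, (block_mx B0 0 0 D0), (block_mx B1 0 0 D1); split.
- by rewrite tr_block_mx map_block_mx !trmx0 !map_mx0 B0h D0h.
- by rewrite tr_block_mx map_block_mx !trmx0 !map_mx0 B1h D1h.
rewrite !map_block_mx !map_mx0 scale_block_mx add_block_mx !scaler0 !addr0.
by rewrite /char_poly char_block_diag_mx det_ublock -!/(char_poly _) gE hE.
Qed.

End Determinantal.

(** * Polynomials determined by their real values *)

Lemma digits_inj N n (a b : 'I_n -> nat) :
  (forall i, a i < N)%N -> (forall i, b i < N)%N ->
  (\sum_i a i * N ^ i = \sum_i b i * N ^ i)%N -> a =1 b.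
Proof.
elim: n a b => [|n IH] a b aN bN; first by move=> _ [].
rewrite !big_ord_recl expn0 !muln1.
have shift (c : 'I_n.+1 -> nat) : (\sum_(i < n) c (lift ord0 i) * N ^ lift ord0 i
     = (\sum_(i < n) c (lift ord0 i) * N ^ i) * N)%N.
  by rewrite big_distrl; apply: eq_bigr => i _; rewrite /= expnSr mulnA.
rewrite !shift => E.
have E0 : a ord0 = b ord0.
  by have := congr1 (modn^~ N) E; rewrite !(addnC (_ ord0)) !modnMDl !modn_small.
have N0 : (0 < N)%N by apply: leq_ltn_trans (aN ord0).
move: E; rewrite E0 => /addnI/eqP; rewrite eqn_pmul2r // => /eqP E i.
case: (unliftP ord0 i) => [j|] -> //.
by apply: (IH (a \o lift ord0) (b \o lift ord0)) => [k|k|]; rewrite ?aN ?bN.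
Qed.

(** Substituting the powers [y ^ (N ^ i)] of a single variable for the variables
    separates the monomials, by uniqueness of the expansion in base [N]. *)
Lemma mpoly_real_eq0 (C : numClosedFieldType) n (p : {mpoly C[n]}) :
  (forall x : 'I_n -> C, (forall i, x i \is Num.real) -> p.@[x] = 0) -> p = 0.
Proof.
move=> Hp; pose N := (msize p).+1; pose w (m : 'X_{1..n}) := (\sum_i m i * N ^ i)%N.
pose P : {poly C} := \sum_(m <- msupp p) p@_m *: 'X^(w m).
have P0 : P = 0.
  apply: poly_real_eq0 => y yR; rewrite -[RHS](Hp (fun i => y ^+ (N ^ i))) => [|i].
    rewrite mevalE /P horner_sum; apply: eq_bigr => m _.
    rewrite hornerZ hornerXn; congr (_ * _).
    by rewrite -prodrXr; apply: eq_bigr => i _; rewrite -exprM mulnC.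
  exact: realX.
have mN m i : m \in msupp p -> (m i < N)%N.
  move=> mp; rewrite ltnS; apply: leq_trans (ltnW (msize_mdeg_lt mp)).
  by rewrite mdegE (bigD1 i) //= leq_addr.
apply/mpolyP => m; rewrite mcoeff0.
have [mp|] := boolP (m \in msupp p); last by move/memN_msupp_eq0.
have := congr1 (fun f : {poly C} => f`_(w m)) P0; rewrite coef0 coef_sum => <-.
rewrite (bigD1_seq m) //= ?msupp_uniq // coefZ coefXn eqxx mulr1.
rewrite big_seq_cond big1 ?addr0 // => m' /andP[m'p m'm].
rewrite coefZ coefXn; case: eqP => [E|]; last by rewrite mulr0.
case/eqP: m'm; apply/mnmP => i; apply/esym.
by apply: (digits_inj (N := N) (n := n)) E i => i; apply: mN.
Qed.

(** * Growth of the roots *)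

Section WeightedDegree.
Variable C : numClosedFieldType.
Implicit Types p q : {poly {poly C}}.

(** Total degree at most [a] in the two variables. *)
Definition tdeg_le a p := forall j, (size (p`_j)%R <= a.+1 - j)%N.

Lemma tdeg_leC c : tdeg_le 0 c%:P%:P.
Proof.
by case=> [|j]; rewrite coefC /= ?subn0 ?size_polyC_leq1 ?size_poly0.
Qed.

Lemma tdeg_le_size a p : tdeg_le a p -> (size p <= a.+1)%N.
Proof.
move=> ap; apply/leq_sizeP => j aj; apply/eqP; rewrite -size_poly_leq0.
by rewrite (leq_trans (ap j)) // leqn0 subn_eq0.
Qed.

Lemma tdeg_leD a p q : tdeg_le a p -> tdeg_le a q -> tdeg_le a (p + q).
Proof.
by move=> ap aq j; rewrite coefD (leq_trans (size_polyD _ _)) // geq_max ap aq.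
Qed.

Lemma tdeg_leM a b p q : tdeg_le a p -> tdeg_le b q -> tdeg_le (a + b) (p * q).
Proof.
move=> ap bq j; rewrite coefM; apply: (leq_trans (size_sum _ _ _)).
apply/bigmax_leqP => i _.
have [->|pi] := eqVneq p`_i 0; first by rewrite mul0r size_poly0.
have [->|qi] := eqVneq q`_(j - i) 0; first by rewrite mulr0 size_poly0.
rewrite size_mul //; move: (ap i) (bq (j - i)%N) (ltn_ord i).
rewrite -!size_poly_gt0 in pi qi; move: (size _) (size _) pi qi => s t; lia.
Qed.

Lemma horner_growth (p : {poly C}) k : (size p <= k.+1)%N ->
  exists2 B, 0 <= B & forall y, `|p.[y]| <= B * (1 + `|y|) ^+ k.
Proof.
move=> sp; exists (\sum_(i < size p) `|p`_i|) => [|y]; first exact: sumr_ge0.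
rewrite horner_coef mulr_suml; apply: le_trans (ler_norm_sum _ _ _) _.
apply: ler_sum => i _; rewrite normrM normrX ler_wpM2l //.
have y1 : 1 <= 1 + `|y| by rewrite lerDl.
apply: le_trans (_ : (1 + `|y|) ^+ i <= _).
  by rewrite lerXn2r ?nnegrE ?addr_ge0 ?ler01 // lerDr.
by rewrite ler_weXn2l // -ltnS (leq_trans (ltn_ord i)).
Qed.

(** Cauchy's bound for the roots, with every coefficient of degree [j] in [t]
    weighted by [(1 + |y|)^(d - j)]. *)
Lemma tdeg_linear_growth d q : q \is monic -> size q = d.+1 -> tdeg_le d q ->
  linear_growth q.
Proof.
move=> qm sq dq; case: d sq dq => [|d] sq dq.
  exists 0 => // y t _ /=; have /size_poly1P[c c0 qE] : size q == 1%N by rewrite sq.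
  have := qm; rewrite qE monicE lead_coefC => /eqP ->.
  by rewrite rmorph1 (negbTE (root1 _)).
have /fin_all_exists2[B B0 HB] (j : 'I_d.+1) : exists2 B, 0 <= B &
    forall y, `|(q`_j).[y]| <= B * (1 + `|y|) ^+ (d.+1 - j).
  by apply: horner_growth; rewrite -subSn ?dq // ltnW.
have S0 : 0 <= \sum_j B j by apply: sumr_ge0.
have K0 : 0 <= 1 + \sum_j B j by rewrite addr_ge0 ?ler01.
exists (1 + \sum_j B j) => // y t yR rt.
set Y := 1 + `|y|; have Y1 : 1 <= Y by rewrite lerDl.
have Y0 : 0 <= Y by apply: le_trans Y1.
rewrite real_leNgt ?realM ?realD ?real1 ?normr_real ?(ger0_real S0) //.
apply/negP => tK.
have Yt : Y <= `|t|.
  by apply: le_trans (ltW tK); rewrite ler_peMl // lerDl.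
have t0 : 0 < `|t| by apply: lt_le_trans Yt; apply: lt_le_trans Y1.
have sf : size (fiber y q) = d.+2.
  rewrite /fiber size_map_poly_id0 // /horner_eval (monicP qm) hornerC.
  exact: oner_neq0.
have : `|t| ^+ d.+1 <= (\sum_j B j) * Y * `|t| ^+ d.
  have := rootP rt; rewrite horner_coef sf big_ord_recr /= coef_fiber.
  have -> : q`_d.+1 = 1 by move/monicP: qm; rewrite lead_coefE sq.
  rewrite hornerC mul1r => /eqP; rewrite addrC addr_eq0 => /eqP tE.
  rewrite -normrX tE normrN mulr_suml mulr_suml.
  apply: le_trans (ler_norm_sum _ _ _) _; apply: ler_sum => j _.
  rewrite coef_fiber normrM normrX.
  apply: le_trans (ler_wpM2r (exprn_ge0 _ (ltW t0)) (HB j y)) _.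
  rewrite -!mulrA ler_wpM2l // subSn -1?ltnS // exprS -mulrA ler_wpM2l //.
  have -> : `|t| ^+ d = `|t| ^+ (d - j) * `|t| ^+ j.
    by rewrite -exprD subnK // -ltnS.
  rewrite ler_wpM2r ?exprn_ge0 //.
  by rewrite lerXn2r ?nnegrE.
rewrite exprS => h.
have : `|t| <= (\sum_j B j) * Y by rewrite -(ler_pM2r (exprn_gt0 d t0)).
rewrite real_leNgt ?normr_real ?realM ?(ger0_real S0) ?(ger0_real Y0) //.
move/negP; apply; apply: le_lt_trans tK.
by rewrite mulrDl mul1r lerDr.
Qed.

End WeightedDegree.

(** * Restricting a homogeneous polynomial to a plane *)

Lemma rmorph_mmap n (A B B' : nzRingType) (phi : {rmorphism B -> B'})
    (f : A -> B) (h : 'I_n -> B) (p : {mpoly A[n]}) :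
  phi (mmap f h p) = mmap (phi \o f) (phi \o h) p.
Proof.
rewrite /mmap rmorph_sum; apply: eq_bigr => m _; rewrite rmorphM /mmap1 rmorph_prod.
by congr (_ * _); apply: eq_bigr => i _; rewrite rmorphXn.
Qed.

Lemma eq_mmap n (A B : nzRingType) (f g : A -> B) (h k : 'I_n -> B)
    (p : {mpoly A[n]}) : f =1 g -> h =1 k -> mmap f h p = mmap g k p.
Proof.
move=> fg hk; rewrite /mmap; apply: eq_bigr => m _; rewrite fg.
by congr (_ * _); apply: eq_bigr => i _; rewrite hk.
Qed.

Lemma meval_map_mpoly n (A B : comNzRingType) (phi : {rmorphism A -> B})
    (x : 'I_n -> A) (p : {mpoly A[n]}) :
  (map_mpoly phi p).@[phi \o x] = phi p.@[x].
Proof.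
rewrite /map_mpoly /meval -/(meval _) [LHS]rmorph_mmap [RHS]rmorph_mmap.
by apply: eq_mmap => i /=; [exact: mevalC | exact: mevalXU].
Qed.

Lemma meval_homog n d (A : comNzRingType) (p : {mpoly A[n]}) (z : A) x :
  p \is d.-homog -> p.@[fun i => z * x i] = z ^+ d * p.@[x].
Proof.
move=> /dhomogP pd; rewrite !mevalE mulr_sumr !big_seq; apply: eq_bigr => m mp.
rewrite mulrCA; congr (_ * _); rewrite -(pd m mp) /= mdegE -prodrXr -big_split /=.
by apply: eq_bigr => i _; rewrite exprMn.
Qed.

Lemma line_restr_eval (R : realType) n (f : {mpoly R[n]}) e a t :
  (line_restr f e a).[t] = f.@[fun i => e i * t + a i].
Proof.
rewrite -[LHS]/(horner_eval t _) /line_restr [LHS]rmorph_mmap.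
by apply: eq_mmap => i; rewrite /= /horner_eval !hornerE.
Qed.

(** The vectors [b] and [c] are the two coordinate vectors other than the one of
    index [i0]; the coefficients of the coordinate forms in the basis [e, b, c] are
    [T], [Y] and [Z]. *)
Lemma complete_frame (K : fieldType) (e : 'I_3 -> K) i0 : e i0 != 0 ->
  exists (b c T Y Z : 'I_3 -> K),
  [/\ forall x i, x i = (\sum_j x j * T j) * e i + (\sum_j x j * Y j) * b i
        + (\sum_j x j * Z j) * c i,
      \sum_j e j * T j = 1, \sum_j e j * Y j = 0, \sum_j e j * Z j = 0
    & \sum_j c j * Z j = 1].
Proof.
move=> ei0; pose dl i j : K := (i == j :> 'I_3)%:R.
have sdl (x : 'I_3 -> K) i : \sum_j x j * dl i j = x i.
  rewrite (bigD1 i) //= /dl eqxx mulr1 big1 ?addr0 // => j ji.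
  by rewrite eq_sym (negbTE ji) mulr0.
pose i1 := lift i0 (0 : 'I_2); pose i2 := lift i0 (1 : 'I_2).
pose T j := dl i0 j / e i0.
have sT x : \sum_j x j * T j = x i0 / e i0.
  by under eq_bigr do rewrite mulrA; rewrite -mulr_suml sdl.
have sY x i : \sum_j x j * (dl i j - e i * T j) = x i - x i0 / e i0 * e i.
  under eq_bigr do rewrite mulrBr mulrCA; rewrite sumrB sdl -mulr_sumr sT.
  by rewrite [e i * _]mulrC.
exists (dl i1), (dl i2), T, (fun j => dl i1 j - e i1 * T j),
  (fun j => dl i2 j - e i2 * T j).
have n1 : i1 != i0 by rewrite eq_sym neq_lift.
have n2 : i2 != i0 by rewrite eq_sym neq_lift.
have n12 : i1 != i2 by rewrite (inj_eq lift_inj).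
split.
- move=> x i; rewrite sT !sY.
  have [->|[->|->]] : i = i0 \/ i = i1 \/ i = i2.
    case: (unliftP i0 i) => [j|] ->; last by left.
    right; case: j => -[|[|//]] lj; [left|right]; congr lift; exact: val_inj.
  + by rewrite /dl (negbTE n1) (negbTE n2) !mulr0 !addr0 mulfVK.
  + by rewrite /dl eqxx eq_sym (negbTE n12) mulr0 mulr1 addr0 subrKC.
  + by rewrite /dl eqxx (negbTE n12) mulr0 mulr1 addr0 subrKC.
- by rewrite sT mulfV.
- by rewrite sY mulfV // mul1r subrr.
- by rewrite sY mulfV // mul1r subrr.
- by rewrite sY /dl eqxx (negbTE n2) mul0r mul0r subr0.
Qed.

Section Dehomogenization.
Variables (K : fieldType) (C : numClosedFieldType) (phi : {rmorphism K -> C}).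
Variables (n : nat) (f : {mpoly K[n]}) (e b c : 'I_n -> K).

(** The restriction of [f] to the plane [t e + y b + c], as a polynomial in [t]
    with coefficients in [y]. *)
Definition plane_restr : {poly {poly C}} :=
  mmap (fun a => (phi a)%:P%:P)
    (fun i => (phi (e i))%:P%:P * 'X + (phi (b i) *: 'X + (phi (c i))%:P)%:P) f.

Lemma fiber_plane_restr (y : K) :
  fiber (phi y) plane_restr = map_poly phi
    (mmap polyC (fun i => e i *: 'X + (b i * y + c i)%:P) f).
Proof.
rewrite /fiber (rmorph_mmap (map_poly (horner_eval (phi y)))) (rmorph_mmap (map_poly phi)).
apply: eq_mmap => i /=; first by rewrite !map_polyC /= /horner_eval hornerC.
rewrite rmorphD rmorphM /= !map_polyC map_polyX /= /horner_eval.
rewrite rmorphD /= map_polyZ map_polyX map_polyC mul_polyC hornerC /=.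
by rewrite hornerD hornerZ hornerX hornerC [X in _ = _ + X%:P]rmorphD rmorphM.
Qed.

(** Every monomial of degree [d] becomes a product of [d] linear factors
    [e_i t + b_i y + c_i]; total degrees add, and so do the top degrees in [t],
    where the coefficients multiply. *)
Lemma plane_restr_top d : f \is d.-homog ->
  tdeg_le d plane_restr /\ plane_restr`_d = (phi f.@[e])%:P.
Proof.
pose top a p (k : K) := tdeg_le a p /\ p`_a = (phi k)%:P.
have topM a1 p1 k1 a2 p2 k2 : top a1 p1 k1 -> top a2 p2 k2 ->
    top (a1 + a2)%N (p1 * p2) (k1 * k2).
  move=> [t1 c1] [t2 c2]; split; first exact: tdeg_leM.
  have [_ ->] := coefM_top (tdeg_le_size t1) (tdeg_le_size t2).
  by rewrite c1 c2 -polyCM (rmorphM phi).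
have top0 k : top 0%N (phi k)%:P%:P k.
  by split; [exact: tdeg_leC | rewrite coefC].
have top1 : top 0%N 1 1 by have := top0 1; rewrite /top rmorph1 !polyC1.
have topX a p k r : top a p k -> top (a * r)%N (p ^+ r) (k ^+ r).
  move=> pk; elim: r => [|r IH]; first by rewrite muln0 !expr0; exact: top1.
  by rewrite !exprS mulnS; apply: topM.
move=> /dhomogP fd.
rewrite /plane_restr /mmap mevalE; move: (msupp f) fd; elim=> [|m s IH] sd.
  rewrite !big_nil; split; last by rewrite coef0 rmorph0.
  by move=> j; rewrite coef0 size_poly0.
rewrite !big_cons.
have [|IHt IHc] := IH; first by move=> m' m's; apply: sd; rewrite inE m's orbT.
suff [t0 c0] : top d ((phi f@_m)%:P%:P * mmap1 (fun i => (phi (e i))%:P%:P * 'X +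
    (phi (b i) *: 'X + (phi (c i))%:P)%:P) m) (f@_m * \prod_i e i ^+ m i).
  split; first exact: tdeg_leD.
  by rewrite coefD c0 IHc -polyCD (rmorphD phi).
rewrite -[d]add0n; apply: (topM) => //; rewrite -(sd m) ?mem_head //= mdegE.
rewrite /mmap1; pose rel p a k := top a p k.
apply: (big_rec3 rel) => [|i k a p _ pk]; first exact: top1.
apply: topM => //; rewrite -[X in top X](mul1n (m i)); apply: topX; split=> [j|].
  rewrite coefD coefCM coefX coefC; case: j => [|[|j]] /=.
  - rewrite mulr0 add0r (leq_trans (size_polyD _ _)) // geq_max.
    by rewrite (leq_trans (size_scale_leq _ _)) ?size_polyX // ltnW // ltnS size_polyC_leq1.
  - by rewrite mulr1 addr0 size_polyC_leq1.
  - by rewrite mulr0 addr0 size_poly0.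
by rewrite coefD coefCM coefX coefC /= mulr1 addr0.
Qed.

End Dehomogenization.

(** * Hermitian determinantal representations *)

Section Pencils.
Variable R : realType.
Local Notation toC := (real_complex R) (only parsing).

Lemma toC_real (x : R) : toC x \is Num.real.
Proof. by rewrite complex_real. Qed.

Lemma hyperbolic_real_rooted (f : {mpoly R[3]}) e b c :
  hyperbolic f e -> real_rooted (plane_restr (real_complex R) f e b c).
Proof.
move=> [_ hyp] y t /complex_realP[y0 ->]; rewrite fiber_plane_restr => /hyp.
by case: t => a k /= ->; rewrite complex_real.
Qed.

Lemma plane_restr_eval (f : {mpoly R[3]}) e b c (y t : R) :
  (fiber (toC y) (plane_restr (real_complex R) f e b c)).[toC t] =
    toC f.@[fun i => e i * t + (b i * y + c i)].
Proof. by rewrite fiber_plane_restr horner_map line_restr_eval. Qed.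

Lemma homog_neq0 (f : {mpoly R[3]}) e d : (0 < d)%N -> f \is d.-homog ->
  f.@[e] != 0 -> exists i, e i != 0.
Proof.
move=> d0 fd fe; apply/existsP; apply: contraR fe => /existsPn e0.
have -> : f.@[e] = f.@[fun i => 0 * e i].
  by apply: meval_eq => i; rewrite mul0r; apply/eqP; have := e0 i; rewrite negbK.
by rewrite (meval_homog _ _ fd) expr0n gtn_eqF // mul0r.
Qed.

(** The pencil is found on the plane [z = 1]; homogeneity extends the identity to
    all points off the plane [z = 0]. *)
Lemma hyperbolic_det_affine (f : {mpoly R[3]}) d e b c : f \is d.-homog ->
  hyperbolic f e ->
  exists A0 A1 : 'M[R[i]]_d, [/\ A0^t* = A0, A1^t* = A1
    & forall t y z, z != 0 ->
      toC f.@[fun i => e i * t + b i * y + c i * z] =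
      toC f.@[e] * \det ((toC t)%:M - (toC y *: A1 + toC z *: A0))].
Proof.
move=> fd hyp; have [fe0 _] := hyp.
have c0 : toC f.@[e] != 0 by rewrite fmorph_eq0.
have [tF F1] := plane_restr_top (real_complex R) e b c fd.
set F := plane_restr (real_complex R) f e b c in tF F1.
pose q := ((toC f.@[e])^-1)%:P%:P * F.
have tq : tdeg_le d q by rewrite -[d]add0n; apply: tdeg_leM => //; apply: tdeg_leC.
have q1 : q`_d = 1 by rewrite coefCM F1 -polyCM mulVf.
have sq : size q = d.+1.
  apply/eqP; rewrite eqn_leq tdeg_le_size //= ltnNge; apply/negP => sq.
  by have /eqP := q1; rewrite nth_default // eq_sym oner_eq0.
have qm : q \is monic by rewrite monicE lead_coefE sq q1.
have fq y : fiber y q = ((toC f.@[e])^-1)%:P * fiber y F.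
  by rewrite rmorphM /= /fiber map_polyC /= /horner_eval hornerC.
have qr : real_rooted q.
  move=> y t yR; rewrite fq rootM rootC invr_eq0 (negbTE c0) /=.
  exact: hyperbolic_real_rooted.
have [n [A0 [A1 [A0h A1h AE]]]] :=
  real_rooted_pencil qm qr (tdeg_linear_growth qm sq tq).
have /eqP := sq; rewrite -AE size_char_poly eqSS => /eqP nd.
case: d / nd fd {tF F1 tq q1 sq} => fd; exists A0, A1; split=> // t y z z0.
have zC : toC z != 0 by rewrite fmorph_eq0.
have -> : f.@[fun i => e i * t + b i * y + c i * z] =
    z ^+ n * f.@[fun i => e i * (t / z) + (b i * (y / z) + c i)].
  rewrite -(meval_homog _ _ fd); apply: meval_eq => i; field; exact: z0.
rewrite rmorphM rmorphXn /= -plane_restr_eval -/F.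
have -> : fiber (toC (y / z)) F = (toC f.@[e])%:P * fiber (toC (y / z)) q.
  by rewrite fq mulrA -polyCM mulfV // mul1r.
rewrite hornerM hornerC mulrCA; congr (_ * _).
rewrite -AE fiber_char_poly /char_poly -[_.[_]]/(horner_eval _ _) -det_map_mx -detZ.
congr determinant; apply/matrixP => i j; rewrite !mxE /= /horner_eval !hornerE.
rewrite rmorph_div ?unitfE //= rmorph_div ?unitfE //=.
case: (i == j); rewrite ?mulr1n ?mulr0n !hornerE; field; exact: zC.
Qed.

Lemma posdef_diag_sqr n (s : 'rV[R[i]]_n) :
  (forall i, 0 < s 0 i) -> posdefmx (diag_mx s *m diag_mx s).
Proof.
move=> s0; have sh : (diag_mx s)^t* = diag_mx s.
  rewrite tr_diag_mx map_diag_mx; congr diag_mx; apply/rowP => i.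
  by rewrite mxE; apply/CrealP; rewrite gtr0_real.
split; first by rewrite hermsymmxE trmx_mul map_mxM sh.
move=> v v0; rewrite mulmxA -mulmxA -{1}sh -map_mxM -trmx_mul.
have /cV0Pn[k wk] : diag_mx s *m v != 0.
  apply: contra v0 => /eqP/matrixP sv; apply/eqP/matrixP => i j.
  have /eqP := sv i j; rewrite mul_diag_mx !mxE mulf_eq0 (gt_eqF (s0 i)) /=.
  by move/eqP.
move: (diag_mx s *m v) k wk => w k wk.
rewrite mxE (bigD1 k) //= ltr_pwDl ?sumr_ge0 // => [|i _].
  by rewrite !mxE mulrC -normCK exprn_gt0 // normr_gt0.
by rewrite !mxE mulrC -normCK exprn_ge0.
Qed.

Lemma meval_det_pencil n d (M : 'I_n -> 'M[R[i]]_d) (x : 'I_n -> R[i]) :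
  (\det (pencil M)).@[x] = \det (\sum_i x i *: M i).
Proof.
rewrite -[_.@[_]]/(meval x _) -det_map_mx; congr determinant.
apply/matrixP => i j; rewrite mxE /pencil !summxE rmorph_sum; apply: eq_bigr => k _.
by rewrite !mxE rmorphM /= mevalXU mevalC.
Qed.

End Pencils.

Local Notation toC := (real_complex _) (only parsing).

Theorem corollary4p10 (R : realType) (d : nat) (hd : (1 <= d)%N)
    (f : {mpoly R[3]}) (hf : f \is d.-homog)
    (e : 'I_3 -> R) (hyp : hyperbolic f e) (fe_gt0 : 0 < f.@[e]) :
  exists M : 'I_3 -> 'M[R[i]]_d,
    [/\ forall i, M i \is hermsymmx,
        map_mpoly (real_complex R) f = \det (pencil M)
      & exists e' : 'I_3 -> R,
          posdefmx (\sum_(i < 3) real_complex R (e' i) *: M i)].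
Proof.
case: d hd hf => // d _ hf.
have [fe0 _] := hyp.
have [i0 ei0] := homog_neq0 (ltn0Sn d) hf fe0.
have [b [c [T [Y [Z [frame eT eY eZ cZ]]]]]] := complete_frame ei0.
have [A0 [A1 [A0h A1h Adet]]] := hyperbolic_det_affine b c hf hyp.
(* The congruence by [S] multiplies the determinant by [f (e)]. *)
pose s : 'rV[R[i]]_d.+1 :=
  \row_i if i == ord0 then sqrtC (toC f.@[e]) else 1.
have fe0C : 0 < toC f.@[e] by rewrite ltcR.
have s0 i : 0 < s 0 i by rewrite mxE; case: ifP; rewrite ?sqrtC_gt0 ?ltr01.
pose S := diag_mx s.
have Sh : S^t* = S.
  rewrite tr_diag_mx map_diag_mx; congr diag_mx; apply/rowP => i.
  by rewrite mxE; apply/CrealP; rewrite gtr0_real.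
have detS : \det S * \det S = toC f.@[e].
  rewrite det_diag big_ord_recl big1 => [|i _]; last by rewrite mxE.
  by rewrite mulr1 mxE eqxx -expr2 sqrtCK.
pose X i := (toC (T i))%:M - (toC (Y i) *: A1 + toC (Z i) *: A0).
have Xh i : (X i)^t* = X i.
  have sc (a : R) (A : 'M[R[i]]_d.+1) : A^t* = A -> (toC a *: A)^t* = toC a *: A.
    by move=> Ah; rewrite linearZ /= map_mxZ /= Ah (CrealP (toC_real a)).
  rewrite /X linearB linearD /= map_mxB map_mxD !sc //.
  by rewrite tr_scalar_mx map_scalar_mx /= (CrealP (toC_real _)).
pose M i := S *m X i *m S.
have Msum (x : 'I_3 -> R) : \sum_i toC (x i) *: M i =
    S *m ((toC (\sum_j x j * T j))%:M - (toC (\sum_j x j * Y j) *: A1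
      + toC (\sum_j x j * Z j) *: A0)) *m S.
  have -> : (toC (\sum_j x j * T j))%:M - (toC (\sum_j x j * Y j) *: A1
      + toC (\sum_j x j * Z j) *: A0) = \sum_i toC (x i) *: X i.
    rewrite /X; under [RHS]eq_bigr do rewrite scalerBr scalerDr !scalerA.
    rewrite sumrB big_split /= -!scaler_suml !rmorph_sum /=; congr (_ - (_ + _)).
    - by apply: eq_bigr => i _; rewrite scale_scalar_mx rmorphM.
    - by congr (_ *: _); apply: eq_bigr => i _; rewrite rmorphM.
    - by congr (_ *: _); apply: eq_bigr => i _; rewrite rmorphM.
  rewrite mulmx_sumr mulmx_suml; apply: eq_bigr => i _.
  by rewrite -scalemxAr -scalemxAl.
exists M; split.
- by move=> i; rewrite hermsymmxE /M !trmx_mul !map_mxM Xh Sh mulmxA.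
- (* Multiplying by the equation [g] of the plane [z = 0] extends the identity to
     the points of this plane. *)
  pose g : {mpoly R[i][3]} := \sum_j toC (Z j) *: 'X_j.
  have g0 : g != 0.
    have gc : g.@[toC \o c] = 1.
      rewrite -(rmorph1 (real_complex R)) -cZ rmorph_sum raddf_sum.
      by apply: eq_bigr => j _; rewrite /= mevalZ mevalXU rmorphM mulrC.
    by apply/eqP => g0; have /eqP := gc; rewrite g0 meval0 eq_sym oner_eq0.
  suff /eqP : (map_mpoly toC f - \det (pencil M)) * g = 0.
    by rewrite mulf_eq0 (negbTE g0) orbF subr_eq0 => /eqP.
  apply: mpoly_real_eq0 => x0 x0R.
  pose x i := complex.Re (x0 i).
  have -> (p : {mpoly R[i][3]}) : p.@[x0] = p.@[toC \o x].
    by apply: meval_eq => i; rewrite /= [toC _]RRe_real.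
  rewrite mevalM mevalB meval_map_mpoly meval_det_pencil.
  rewrite (Msum x).
  have -> : g.@[toC \o x] = toC (\sum_j x j * Z j).
    rewrite /g raddf_sum rmorph_sum; apply: eq_bigr => j _.
    by rewrite /= mevalZ mevalXU rmorphM mulrC.
  have [->|z0] := eqVneq (\sum_j x j * Z j) 0; first by rewrite rmorph0 mulr0.
  apply/eqP; rewrite mulf_eq0 subr_eq0; apply/orP; left; apply/eqP.
  rewrite !det_mulmx mulrAC detS -Adet //; congr toC; apply: meval_eq => i.
  by rewrite frame; congr (_ + _ + _); rewrite mulrC.
- exists e; rewrite Msum eT eY eZ !rmorph0 !scale0r addr0 subr0 rmorph1 mulmx1.
  exact: posdef_diag_sqr.
Qed.
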